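(* For every sufficiently small constant $\epsilon>0$ there exists a function $N(n)=\Theta(n^2)$ such that for all $n,k\in\mathbb N$ and all $N\ge N(n)$ the following holds: letting $\Psi$ be the set of $n$-block strings in $\{0,1\}^N$, any $(\Psi,\mathrm{far}^{\mathrm{rel\text{-}edit}}_\epsilon(\Psi),\rho,2/3)$-trace tester using $k$ traces of expected size $\rho N$ must satisfy $k\rho N=\Omega(n/\log n)$.
   Context: A block is a maximal run of equal symbols; $x$ is an $n$-block string if it has at most $n$ blocks. A trace of $x\in\{0,1\}^N$ with retention rate $\rho$ is obtained by deleting each character independently with probability $1-\rho$ (expected size $\rho N$). A $(\Psi_1,\Psi_2,\rho,\alpha)$-trace tester using $k$ traces receives $k$ independent traces of the unknown $x$, accepts with probability $\ge\alpha$ if $x\in\Psi_1$ and rejects with probability $\ge\alpha$ if $x\in\Psi_2$. $d_{\mathrm{rel\text{-}edit}}(x,y)=\frac{2}{N+M}\mathrm{ed}(x,y)$ with $\mathrm{ed}$ the standard edit distance, and $\mathrm{far}^{\mathrm{rel\text{-}edit}}_\epsilon(\Psi)=\{x\in\{0,1\}^N:\min_{y\in\Psi}d_{\mathrm{rel\text{-}edit}}(x,y)>\epsilon\}$. *)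

(* Defs.v *)
From HB Require Import structures.
From mathcomp Require Import all_boot all_order all_algebra.
From mathcomp Require Import all_classical all_reals all_analysis.

Set Implicit Arguments.
Unset Strict Implicit.
Unset Printing Implicit Defensive.

Import Order.TTheory GRing.Theory Num.Theory.
Import numFieldNormedType.Exports.

Local Open Scope ring_scope.

Section Blocks.

Variable N : nat.
Implicit Types (x : N.-tuple bool) (B : {set 'I_N}).

(* B is an interval of positions on which x is constant. *)
Definition is_run x B : bool :=
  [forall i in B, forall j in B,
    (tnth x i == tnth x j) && [forall k : 'I_N, (i <= k <= j)%N ==> (k \in B)]].

(* The nonemptiness condition only matters when N = 0. *)
Definition blocks x : {set {set 'I_N}} :=
  [set B : {set 'I_N} | (0 < #|B|)%N && maxset (is_run x) B].

Definition block_strings (n : nat) : {set N.-tuple bool} :=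
  [set x : N.-tuple bool | (#|blocks x| <= n)%N].

End Blocks.

Section EditDistance.

Inductive edit_step : seq bool -> seq bool -> Prop :=
| edit_insert u v b : edit_step (u ++ v) (u ++ b :: v)
| edit_delete u v b : edit_step (u ++ b :: v) (u ++ v)
| edit_subst u v b c : edit_step (u ++ b :: v) (u ++ c :: v).

Inductive edit_path : nat -> seq bool -> seq bool -> Prop :=
| edit_path0 x : edit_path 0 x x
| edit_pathS k x y z : edit_step x y -> edit_path k y z -> edit_path k.+1 x z.

Lemma edit_path_exists (x y : seq bool) : exists k, `[< edit_path k x y >].
Proof.
have ins z : exists k, edit_path k [::] z.
  suff H w : exists k, edit_path k w (z ++ w) by have := H [::]; rewrite cats0.
  elim/last_ind: z w => [|z b IHz] w; first by exists 0%N; exact: edit_path0.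
  have [k Hk] := IHz (b :: w); exists k.+1; rewrite cat_rcons.
  by apply: edit_pathS Hk; exact: (edit_insert [::]).
elim: x => [|b x [k /asboolP Hk]].
  by have [k Hk] := ins y; exists k; exact/asboolP.
exists k.+1; apply/asboolP; apply: edit_pathS Hk.
exact: (edit_delete [::]).
Qed.

Definition ed (x y : seq bool) : nat := ex_minn (edit_path_exists x y).

End EditDistance.

Section TraceTesting.

Variable R : realType.

Definition d_rel_edit (x y : seq bool) : R :=
  2 / (size x + size y)%:R * (ed x y)%:R.

(* The minimum is taken in \bar R so that it is +oo when Psi is empty. *)
Definition dist_rel_edit N (x : N.-tuple bool) (Psi : {set N.-tuple bool}) :
    \bar R :=
  \big[Order.min/+oo%E]_(y in Psi) (d_rel_edit x y)%:E.

Definition far_rel_edit N (eps : R) (Psi : {set N.-tuple bool}) :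
    {set N.-tuple bool} :=
  [set x | (eps%:E < dist_rel_edit x Psi)%E].

(* Characters whose bit in the mask is true are retained. *)
Definition mask_prob N (rho : R) (m : N.-tuple bool) : R :=
  \prod_(i < N) (if tnth m i then rho else 1 - rho).

(* A tester may be randomized: [T t] is its probability of accepting when the
   k traces it receives are t, so this is its overall acceptance probability
   on k independent traces of x. *)
Definition accept_prob N k (rho : R) (T : k.-tuple (seq bool) -> R)
    (x : N.-tuple bool) : R :=
  \sum_(m : k.-tuple (N.-tuple bool))
    (\prod_(j < k) mask_prob rho (tnth m j)) * T [tuple mask (tnth m j) x | j < k].

Definition trace_tester N (Psi1 Psi2 : {set N.-tuple bool}) (rho alpha : R)
    k (T : k.-tuple (seq bool) -> R) : Prop :=
  [/\ forall t, 0 <= T t <= 1,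
      forall x, x \in Psi1 -> alpha <= accept_prob rho T x
    & forall x, x \in Psi2 -> alpha <= 1 - accept_prob rho T x].

End TraceTesting.

(* Main.v *)
Require Import Defs.
From HB Require Import structures.
From mathcomp Require Import all_boot all_order all_algebra.
From mathcomp Require Import all_classical all_reals all_analysis.
From mathcomp Require Import zify ring lra.

Set Implicit Arguments.
Unset Strict Implicit.
Unset Printing Implicit Defensive.
Import Order.TTheory GRing.Theory Num.Theory.
Import numFieldNormedType.Exports.
Local Open Scope ring_scope.

(** The hard strings are concatenations of 4n cells 0^a 1^l with i.i.d. lengths
    l, padded with zeros to length N.  The lengths are drawn from one of two laws
    on multiples of a whose moments agree up to degree D ~ log n; under the first
    law most l vanish, so there are few blocks, while under the second every l is
    at least a, so every block must be erased at cost a.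

    Let g(l) be the acceptance probability as a function of a single l: raising l
    by one moves a symbol from the padding to the cell.  This is irrelevant when
    the symbol is retained in none of the k traces, so the s-th difference of g at 0 is at most (2 k rho)^s.  In the
    Newton expansion of g the terms of degree at most D cancel between the two
    laws, and the others form a tail of size 2^-D as soon as k rho max l is at most
    a small multiple of D.  Exchanging the laws cell by cell bounds the total
    difference, except when the padding is exhausted, which a Chernoff bound makes
    unlikely.

    The laws live on 0, 1 and the points y_i = 1 + 200 (1 + 16 (i - m)^2), with
    weights obtained by dividing those of the (2m)-th finite difference by
    y_i (y_i - 1): the two extra factors keep the mean bounded and put almost all
    the mass on 0 and 1, one for each law. *)

(** * Edit distance and blocks *)

Lemma subseq_catP (z u v : seq bool) :
  subseq z (u ++ v) ->
  exists z1 z2 : seq bool, [/\ z = z1 ++ z2, subseq z1 u & subseq z2 v].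
Proof.
case/subseqP => m sm ->.
exists (mask (take (size u) m) u), (mask (drop (size u) m) v).
split; [|exact: mask_subseq|exact: mask_subseq].
rewrite -mask_cat ?cat_take_drop //.
by rewrite size_takel // sm size_cat leq_addr.
Qed.

Lemma subseq_cat_consP (z u v : seq bool) b :
  subseq z (u ++ b :: v) ->
  exists z' : seq bool, [/\ subseq z' z, subseq z' (u ++ v) & (size z <= (size z').+1)%N].
Proof.
case/subseq_catP => z1 [z2 [-> h1 h2]].
have [z3 [h3 h4 h5]] :
    exists z3 : seq bool, [/\ subseq z3 z2, subseq z3 v & (size z2 <= (size z3).+1)%N].
  case: z2 h2 => [|c z2] /=; first by exists [::]; split; rewrite ?sub0seq.
  case: eqP => _ h; first by exists z2; split=> //; exact: subseq_cons.
  by exists (c :: z2); split => //=; rewrite ?eqxx.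
exists (z1 ++ z3); split; [exact: cat_subseq | exact: cat_subseq |].
by rewrite !size_cat; lia.
Qed.

(** Undoing an insertion or a substitution costs the common subsequence at most one symbol; undoing
    a deletion costs none but lengthens the source by one. *)
Lemma edit_path_lcs k x y : edit_path k x y ->
  exists z : seq bool, [/\ subseq z x, subseq z y & (size x <= size z + k)%N].
Proof.
elim => {k x y} [x|k x y z xy _ [w [wy wz sw]]].
  by exists x; split; rewrite ?addn0.
suff [w' [h1 h2 h3]] : exists w' : seq bool,
    [/\ subseq w' w, subseq w' x & (size x + size w <= size w' + size y + 1)%N].
  exists w'; split=> //; first exact: subseq_trans wz.
  by move: sw h3; lia.
have weaken (u v : seq bool) b : subseq (u ++ v) (u ++ b :: v).
  by apply: cat_subseq => //; exact: subseq_cons.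
case: xy wy => {x y sw} [u v b|u v b|u v b c] wy.
- have [w' [h1 h2 h3]] := subseq_cat_consP wy; exists w'; split=> //.
  by rewrite !size_cat /=; lia.
- exists w; split => //; first exact: subseq_trans (weaken _ _ _).
  by rewrite !size_cat /=; lia.
- have [w' [h1 h2 h3]] := subseq_cat_consP wy; exists w'; split=> //.
    exact: subseq_trans (weaken _ _ _).
  by rewrite !size_cat /=; lia.
Qed.

Lemma ed_lcs x y :
  exists z : seq bool, [/\ subseq z x, subseq z y & (size x <= size z + ed x y)%N].
Proof. by rewrite /ed; case: ex_minnP => k /asboolP /edit_path_lcs. Qed.

(** * Counting blocks through symbol changes *)

Section Runs.

(** The argument [c] stands for the symbol just before [s], so that the count can be continued
    across a concatenation. *)
Fixpoint changes (c : bool) (s : seq bool) : nat :=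
  if s is b :: s' then ((c != b) + changes b s')%N else 0%N.

Fixpoint ascents (c : bool) (s : seq bool) : nat :=
  if s is b :: s' then ((~~ c && b) + ascents b s')%N else 0%N.

Lemma changes_tri c b s : (changes c s <= (c != b) + changes b s)%N.
Proof. by case: s => [|d s] //=; case: c; case: b; case: d => /=; lia. Qed.

Lemma changes_subseq z y c : subseq z y -> (changes c z <= changes c y)%N.
Proof.
elim: y z c => [|b y IH] [|b' z] c //=.
case: eqP => [-> h|_ h]; first by rewrite leq_add2l IH.
apply: leq_trans (changes_tri c b y); exact: (IH (b' :: z)).
Qed.

Lemma ascents_changes c s : (ascents c s <= changes c s)%N.
Proof. by elim: s c => [|b s IH] c //=; case: c; case: b => /=; have := IH true; have := IH false; lia. Qed.

Lemma ascents_true_le c s : (ascents true s <= ascents c s)%N.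
Proof. by case: c s => [] // [|[] s] /=; lia. Qed.

Lemma ascents_nseq_cat c p b s :
  ascents c (nseq p b ++ s) =
  if p is 0 then ascents c s else ((~~ c && b) + ascents b s)%N.
Proof.
case: p => // p /=; congr addn.
by elim: p => //= p ->; case: b.
Qed.

Lemma changes_nseq_cat c p b s :
  changes c (nseq p b ++ s) =
  if p is 0 then changes c s else ((c != b) + changes b s)%N.
Proof.
case: p => // p /=; congr addn.
by elim: p => //= p ->; case: b.
Qed.

Definition run_end (s : seq bool) (i : nat) : bool :=
  (i.+1 == size s) || (nth false s i != nth false s i.+1).

Lemma count_run_end b s :
  count (run_end (b :: s)) (iota 0 (size s).+1) = (changes b s).+1.
Proof.
elim: s b => [|c s IH] b; first by [].
have -> : iota 0 (size (c :: s)).+1 = 0%N :: map succn (iota 0 (size s).+1).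
  by rewrite -[RHS]/(0%N :: map (addn 1) _) -iotaDl.
rewrite [LHS]/= count_map -addnS -IH; congr addn.
Qed.

Variable N : nat.
Implicit Types (x : N.-tuple bool) (e j : 'I_N).

(** Maximal to the left only: it is a block exactly when [run_end] holds at [e]. *)
Definition run_to x (e : 'I_N) : {set 'I_N} :=
  [set j : 'I_N | (j <= e)%N &&
     [forall k : 'I_N, (j <= k <= e)%N ==> (tnth x k == tnth x e)]].

Lemma run_toP x e j :
  reflect ((j <= e)%N /\ forall k : 'I_N, (j <= k <= e)%N -> tnth x k = tnth x e)
          (j \in run_to x e).
Proof.
rewrite inE; apply: (iffP andP) => -[h1 h2]; split=> //.
  by move=> k hk; have /forallP/(_ k)/implyP/(_ hk)/eqP := h2.
by apply/forallP => k; apply/implyP => /h2 ->.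
Qed.

Lemma run_to_id x e : e \in run_to x e.
Proof. by apply/run_toP; split=> // k hk; congr tnth; apply/val_inj => /=; lia. Qed.

Lemma is_runP x (B : {set 'I_N}) :
  reflect (forall i j, i \in B -> j \in B -> tnth x i = tnth x j /\
             forall k : 'I_N, (i <= k <= j)%N -> k \in B)
          (is_run x B).
Proof.
apply: (iffP idP) => [h i j iB jB|h].
  have /forallP/(_ i)/implyP/(_ iB)/forallP/(_ j)/implyP/(_ jB) := h.
  case/andP => /eqP -> /forallP h2; split=> // k hk.
  by have /implyP/(_ hk) := h2 k.
apply/forallP => i; apply/implyP => iB; apply/forallP => j; apply/implyP => jB.
have [-> h2] := h i j iB jB; rewrite eqxx /=.
by apply/forallP => k; apply/implyP; exact: h2.
Qed.

Lemma run_to_run x e : is_run x (run_to x e).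
Proof.
apply/is_runP => i j /run_toP [ie hi] /run_toP [je hj]; split.
  by rewrite hi ?hj // ?leqnn.
move=> k /andP[ik kj]; apply/run_toP; split; first exact: leq_trans je.
by move=> l /andP[kl le]; apply: hi; rewrite le (leq_trans ik).
Qed.

Lemma run_to_inj x : injective (run_to x).
Proof.
move=> e f E; apply/val_inj/eqP; rewrite eqn_leq.
have /run_toP[-> _] : e \in run_to x f by rewrite -E run_to_id.
by have /run_toP[-> _] : f \in run_to x e by rewrite E run_to_id.
Qed.

(** A block is determined by its last position, so counting blocks amounts to counting ends of
    runs. *)
Lemma blocksE x : blocks x = run_to x @: [set e : 'I_N | run_end x e].
Proof.
apply/setP => B; rewrite inE; apply/idP/imsetP => [|[e]].
  case/andP => /card_gt0P [i0 i0B] /maxsetP [Brun Bmax].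
  have [e eB emax] := @arg_maxnP _ i0 [in B] (fun i => nat_of_ord i) i0B.
  have sB : B \subset run_to x e.
    apply/fintype.subsetP => j jB; apply/run_toP; split; first exact: emax.
    move=> k hk; have [_ h] := is_runP _ _ Brun j e jB eB.
    by have [-> _] := is_runP _ _ Brun k e (h k hk) eB.
  have BE := Bmax _ (run_to_run x e) sB.
  exists e => //; rewrite inE /run_end size_tuple.
  (* If the next symbol agreed, adding its position would give a larger run containing [B]. *)
  case: eqP => //= eN; apply/negP => /eqP E.
  have e1 : (e.+1 < N)%N by move: eN (ltn_ord e); lia.
  have E' : tnth x e = tnth x (Ordinal e1) by rewrite !(tnth_nth false).
  have sB' : B \subset run_to x (Ordinal e1).
    apply/fintype.subsetP => j; rewrite -BE => /run_toP [je hj].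
    apply/run_toP; split => /=; first by lia.
    move=> k /andP[jk]; rewrite leq_eqVlt => /orP[/eqP ke|ke].
      by congr tnth; apply/val_inj.
    by rewrite -E' hj // jk.
  have BE' := Bmax _ (run_to_run x (Ordinal e1)) sB'.
  have /emax : Ordinal e1 \in B by rewrite -BE' run_to_id.
  by rewrite /= ltnn.
rewrite inE => ee ->; apply/andP; split.
  by apply/card_gt0P; exists e; exact: run_to_id.
apply/maxsetP; split; first exact: run_to_run.
move=> C Crun sC; apply/eqP; rewrite finset.eqEsubset sC andbT.
have eC : e \in C by apply: (fintype.subsetP sC); exact: run_to_id.
apply/fintype.subsetP => c cC.
have [ce|ec] := leqP c e.
  apply/run_toP; split=> // k hk.
  have [_ h] := is_runP _ _ Crun c e cC eC.
  by have [-> _] := is_runP _ _ Crun k e (h k hk) eC.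
have [_ h] := is_runP _ _ Crun e c eC cC.
have e1 : (e.+1 < N)%N by move: (ltn_ord c); lia.
have e1C : Ordinal e1 \in C by apply: h => /=; lia.
have [E _] := is_runP _ _ Crun _ _ eC e1C.
move: ee; rewrite /run_end size_tuple.
by rewrite !(tnth_nth false) /= in E; rewrite E eqxx orbF; lia.
Qed.

Lemma card_blocks x : #|blocks x| = count (run_end x) (iota 0 (size x)).
Proof.
rewrite size_tuple blocksE (card_imset _ (@run_to_inj x)) -val_enum_ord count_map.
by rewrite cardE {1}/enum_mem size_filter -enumT; apply: eq_count => i; rewrite /= inE.
Qed.

(** For a nonempty string, [changes c x] is the number of blocks, or one less when [c] is the first
    symbol. *)
Lemma card_blocks_le x c : (#|blocks x| <= (changes c x).+1)%N.
Proof.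
rewrite card_blocks; case: (tval x) => [|b s] //.
by rewrite -[size _]/(size s).+1 count_run_end /=; case: (c != b) => /=; lia.
Qed.

Lemma card_blocks_ge x c : (changes c x <= #|blocks x|)%N.
Proof.
rewrite card_blocks; case: (tval x) => [|b s] //.
by rewrite -[size _]/(size s).+1 count_run_end /=; case: (c != b) => /=; lia.
Qed.

End Runs.

(** * Strings made of cells *)

Definition cells (a : nat) (s : seq nat) : seq bool :=
  flatten [seq nseq a false ++ nseq l true | l <- s].

Lemma size_cells a s : size (cells a s) = (a * size s + sumn s)%N.
Proof.
elim: s => [|l s IH] /=; first by rewrite muln0.
by rewrite /cells /= !size_cat !size_nseq -/(cells a s) IH; lia.
Qed.

Lemma cells_cat a s1 s2 : cells a (s1 ++ s2) = cells a s1 ++ cells a s2.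
Proof. by rewrite /cells map_cat flatten_cat. Qed.

Lemma cells_cons a l s :
  cells a (l :: s) = nseq a false ++ nseq l true ++ cells a s.
Proof. by rewrite /cells /= catA. Qed.

(** A cell with [l = 0] merges into the surrounding zeros; any other cell brings at most one change
    to ones and one change back. *)
Lemma changes_cells a s p :
  (changes false (cells a s ++ nseq p false) <= 2 * count (predC1 0%N) s)%N.
Proof.
elim: s => [|l s IH].
  by rewrite [cells _ _]/= -[_ ++ _]cats0 changes_nseq_cat; case: p.
rewrite cells_cons -!catA !changes_nseq_cat [count _ _]/=.
move: (cells a s ++ nseq p false) IH => y IH.
move: (count _ s) IH (changes_tri true false y) => K; case: a => [|a]; case: l => [|l] /=; lia.
Qed.

Lemma subseq_nseq (b : bool) (z : seq bool) p :
  subseq z (nseq p b) -> z = nseq (size z) b.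
Proof.
move=> zp; apply/all_pred1P/allP => c /(mem_subseq zp).
by rewrite mem_nseq /= => /andP[_].
Qed.

(** A cell of which [z] keeps both a zero and a one yields an ascent. Any other cell has lost all
    its zeros or all its ones, hence at least [a] symbols. *)
Lemma ascents_cells a s p (z : seq bool) :
  all (leq a) s -> subseq z (cells a s ++ nseq p false) ->
  (a * size s + size z <= a * ascents true z + size (cells a s ++ nseq p false))%N.
Proof.
elim: s z => [|l s IH] z /=.
  by move=> _ /size_subseq h; rewrite muln0 (leq_trans h) // leq_addl.
case/andP => al als; rewrite cells_cons -!catA => /subseq_catP [z1 [z' [-> h1]]].
case/subseq_catP => z2 [z3 [-> h2 h3]].
have := IH _ als h3; have := size_subseq h1; have := size_subseq h2.
rewrite (subseq_nseq h1) (subseq_nseq h2) !ascents_nseq_cat.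
rewrite !size_cat !size_nseq.
(* Covers the cells keeping only zeros, after which the rest of [z] is read following a zero instead
   of a one. *)
have := ascents_true_le false z3.
case: (size z1) => [|n1]; case: (size z2) => [|n2] /=; rewrite ?add0n; nia.
Qed.

(** * Newton expansion of the acceptance probability *)

Section TwoShifts.

Variables (R : realType) (V : finType) (w : V -> R) (Z : Type).
Hypotheses (w_ge0 : forall v, 0 <= w v) (w_sum : \sum_v w v = 1).

(** Markov operator of the random move [sh v], with [v] drawn from [w]; for traces, a move offers
    one symbol to all [k] of them. *)
Definition average (sh : V -> Z -> Z) (f : Z -> R) (z : Z) : R :=
  \sum_v w v * f (sh v z).

Lemma average_le sh f b : (forall z, `|f z| <= b) ->
  forall z, `|average sh f z| <= b.
Proof.
move=> fb z; apply: le_trans (ler_norm_sum _ _ _) _.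
rewrite -[leRHS]mul1r -w_sum mulr_suml; apply: ler_sum => v _.
by rewrite normrM ger0_norm // ler_wpM2l.
Qed.

Lemma iter_average_le sh f b n : (forall z, `|f z| <= b) ->
  forall z, `|iter n (average sh) f z| <= b.
Proof. by move=> fb; elim: n => //= n IH; exact: average_le. Qed.

Lemma averageD sh f g :
  average sh (fun z => f z + g z) = fun z => average sh f z + average sh g z.
Proof.
by apply/funext => z; rewrite -big_split; apply: eq_bigr => v _; rewrite mulrDr.
Qed.

Lemma averageB sh f g :
  average sh (fun z => f z - g z) = fun z => average sh f z - average sh g z.
Proof.
by apply/funext => z; rewrite -sumrB; apply: eq_bigr => v _; rewrite mulrBr.
Qed.

Lemma iter_averageD sh n f g :
  iter n (average sh) (fun z => f z + g z) =
  fun z => iter n (average sh) f z + iter n (average sh) g z.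
Proof. by elim: n => //= n ->; rewrite averageD. Qed.

Variables (al be : V -> Z -> Z) (v0 : V).
Hypotheses (al_be0 : forall z, al v0 z = be v0 z)
  (al_beC : forall v v' z, al v (be v' z) = be v' (al v z)).

Definition gap (f : Z -> R) (z : Z) : R := average al f z - average be f z.

(* The two shifts agree at [v0], so only the mass off [v0] contributes. *)
Lemma gap_le f b : (forall z, `|f z| <= b) ->
  forall z, `|gap f z| <= 2 * (1 - w v0) * b.
Proof.
move=> fb z; rewrite /gap /average (bigD1 v0) //= [X in _ - X](bigD1 v0) //=.
rewrite al_be0 opprD addrACA subrr add0r -sumrB.
apply: le_trans (ler_norm_sum _ _ _) _.
have -> : 1 - w v0 = \sum_(v | v != v0) w v.
  by rewrite -w_sum (bigD1 v0) //= addrAC subrr add0r.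
rewrite -mulrA mulrC -mulrA mulr_suml; apply: ler_sum => v _.
rewrite -mulrBr normrM ger0_norm // ler_wpM2l //.
apply: le_trans (ler_normB _ _) _; rewrite mulr_natr mulr2n.
exact: lerD.
Qed.

Lemma iter_gap_le f n : (forall z, `|f z| <= 1) ->
  forall z, `|iter n gap f z| <= (2 * (1 - w v0)) ^+ n.
Proof.
move=> fb; elim: n => [|n IH] z; first by rewrite expr0.
by rewrite iterS exprS; apply: gap_le.
Qed.

Lemma averageC f : average al (average be f) = average be (average al f).
Proof.
apply/funext => z; rewrite /average; under eq_bigr do rewrite mulr_sumr.
rewrite exchange_big; apply: eq_bigr => v _; rewrite mulr_sumr.
by apply: eq_bigr => v' _; rewrite mulrCA al_beC.
Qed.

Lemma iter_averageC n m f :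
  iter n (average al) (iter m (average be) f) =
  iter m (average be) (iter n (average al) f).
Proof.
elim: n => //= n ->; elim: m => //= m <-; exact: averageC.
Qed.

Lemma gap_average f : gap (average be f) = average be (gap f).
Proof. by rewrite /gap averageB averageC. Qed.

Lemma gap_iter_average n f :
  gap (iter n (average be) f) = iter n (average be) (gap f).
Proof. by elim: n => //= n IH; rewrite gap_average IH. Qed.

(** Binomial theorem for the commuting operators [average be] and [gap], whose sum is [average al].
    Any [n > r] may bound the sum, since the coefficients vanish beyond [r]. *)
Lemma average_newton r n : (r < n)%N -> forall q f z,
  iter r (average al) (iter q (average be) f) z =
  \sum_(s < n) 'C(r, s)%:R * iter (q + r - s) (average be) (iter s gap f) z.
Proof.
elim: r n => [|r IH] [|n] // rn q f z.
  rewrite big_ord_recl /= bin0 mul1r addn0 subn0 big1 ?addr0 // => i _.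
  by rewrite bin_small ?mul0r.
rewrite iterSr.
have -> : average al (iter q (average be) f) =
    fun z => iter q.+1 (average be) f z + iter q (average be) (gap f) z.
  by apply/funext => y; rewrite -gap_iter_average /gap iterS addrC subrK.
rewrite iter_averageD (IH n.+1); last by lia.
rewrite (IH n) // !big_ord_recl /= !bin0 !subn0 addSnnS -addrA; congr (_ + _); first by rewrite addnS.
rewrite -big_split; apply: eq_bigr => i _; rewrite /= /bump /= add1n.
by rewrite binS natrD mulrDl addnS subSS -iterSr.
Qed.

(** With [l] moves of one kind and [P - l] of the other, the power [P - s] left on [average be] is
    independent of [l], so one sequence [X] serves all [l]. *)
Lemma average_newton_bounded f z H P : (H <= P)%N ->
  (forall z, `|f z| <= 1) ->
  exists X : nat -> R, (forall s, `|X s| <= (2 * (1 - w v0)) ^+ s) /\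
    forall l, (l <= H)%N ->
      iter l (average al) (iter (P - l) (average be) f) z =
      \sum_(s < H.+1) 'C(l, s)%:R * X s.
Proof.
move=> HP fb.
exists (fun s => iter (P - s) (average be) (iter s gap f) z); split.
  by move=> s; apply: iter_average_le; exact: iter_gap_le.
move=> l lH; rewrite (@average_newton _ H.+1) // subnK //.
exact: leq_trans lH HP.
Qed.

End TwoShifts.

(** * Traces as iterated averages *)

Section Traces.

Variables (R : realType) (k : nat) (rho : R).
Hypothesis rho01 : 0 <= rho <= 1.

Lemma mask_prob_ge0 N (m : N.-tuple bool) : 0 <= mask_prob rho m.
Proof.
case/andP: rho01 => r0 r1; apply: prodr_ge0 => i _.
by case: (tnth m i); rewrite ?subr_ge0.
Qed.

Lemma mask_prob_cons N b (m : N.-tuple bool) :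
  mask_prob rho [tuple of b :: m] = (if b then rho else 1 - rho) * mask_prob rho m.
Proof.
rewrite /mask_prob big_ord_recl tnth0; congr (_ * _).
by apply: eq_bigr => i _; rewrite tnthS.
Qed.

Lemma big_tuple0 (T : finType) (F : 0.-tuple T -> R) : \sum_m F m = F [tuple].
Proof. by rewrite (big_pred1 [tuple]) // => m; apply/esym/eqP/tuple0. Qed.

Lemma big_tupleS (T : finType) N (F : N.+1.-tuple T -> R) :
  \sum_m F m = \sum_(b : T) \sum_(m : N.-tuple T) F [tuple of b :: m].
Proof.
rewrite pair_bigA /=.
rewrite (reindex (fun p : T * N.-tuple T => [tuple of p.1 :: p.2])) //=.
exists (fun m => (thead m, [tuple of behead m])) => [[b m] _|m _] /=.
  by congr pair; apply/val_inj.
by rewrite -tuple_eta.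
Qed.

Lemma mask_prob_sum N : \sum_(m : N.-tuple bool) mask_prob rho m = 1.
Proof.
elim: N => [|N IH]; first by rewrite big_tuple0 /mask_prob big_ord0.
rewrite big_tupleS (eq_bigr (fun b : bool => if b then rho else 1 - rho)).
  by rewrite big_bool /= addrC subrK.
by move=> b _; under eq_bigr do rewrite mask_prob_cons; rewrite -mulr_sumr IH mulr1.
Qed.

Lemma mask_prob_none N :
  mask_prob rho [tuple of nseq N false] = (1 - rho) ^+ N.
Proof.
rewrite /mask_prob (eq_bigr (fun=> 1 - rho)) ?prodr_const ?card_ord // => i _.
by rewrite tnth_nseq.
Qed.

Lemma bernoulli N : 1 - (1 - rho) ^+ N <= N%:R * rho.
Proof.
case/andP: rho01 => r0 r1.
elim: N => [|N IH]; first by rewrite expr0 subrr mul0r.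
rewrite exprS -natr1 mulrDl mul1r.
have : (1 - rho) ^+ N <= 1 by apply: exprn_ile1; lra.
have : 0 <= (1 - rho) ^+ N by apply: exprn_ge0; lra.
move: ((1 - rho) ^+ N) IH => y; nra.
Qed.

(** [v] tells which of the [k] traces retain the symbol; its law is again [mask_prob], with traces
    in the role of positions. *)
Definition extend (b : bool) (v : k.-tuple bool) (t : 'I_k -> seq bool) :=
  fun j => if tnth v j then b :: t j else t j.

(* [trace_mean x Phi t] is the mean of [Phi] at k independent traces of [x],
   the j-th one followed by [t j]. *)
Fixpoint trace_mean (x : seq bool) (Phi : ('I_k -> seq bool) -> R) :=
  if x is b :: x' then trace_mean x' (average (@mask_prob R k rho) (extend b) Phi)
  else Phi.

Lemma accept_prob_trace_mean N (x : N.-tuple bool) (T : k.-tuple (seq bool) -> R) :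
  accept_prob rho T x =
  trace_mean x (fun t => T [tuple t j | j < k]) (fun=> [::]).
Proof.
(* The induction on the string requires an arbitrary [Phi] and arbitrary tails [t]. *)
suff H Phi t : \sum_(m : k.-tuple (N.-tuple bool))
    (\prod_(j < k) mask_prob rho (tnth m j)) *
      Phi (fun j => mask (tnth m j) x ++ t j) = trace_mean x Phi t.
  rewrite -H; apply: eq_bigr => m _; congr (_ * T _).
  by apply: eq_from_tnth => j; rewrite !tnth_mktuple cats0.
elim: N x Phi t => [|N IH] x Phi t.
  rewrite (big_pred1 [tuple [tuple] | j < k]) => [|m]; last first.
    by apply/esym/eqP/eq_from_tnth => j; rewrite tnth_mktuple; exact: tuple0.
  rewrite (tuple0 x) /= big1 ?mul1r => [|j _].
    by congr Phi; apply/funext => j; rewrite tnth_mktuple.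
  by rewrite /mask_prob big_ord0.
case/tupleP: x => b x; rewrite [tval _]/= -[RHS]/(trace_mean x _ t) -IH.
rewrite /average; under [RHS]eq_bigr do rewrite mulr_sumr.
rewrite pair_bigA /=.
(* The masks are split by position: [p.2] decides the fate of the first symbol in all traces, [p.1]
   that of the others. *)
pose g (p : k.-tuple (N.-tuple bool) * k.-tuple bool) :=
  [tuple [tuple of tnth p.2 j :: tnth p.1 j] | j < k].
rewrite (reindex g) /=; last first.
  exists (fun m : k.-tuple (N.+1.-tuple bool) =>
    ([tuple [tuple of behead (tnth m j)] | j < k],
     [tuple thead (tnth m j) | j < k])) => [[m v] _|m _] /=.
    by congr pair; apply: eq_from_tnth => j; rewrite !tnth_mktuple //=;
       apply/val_inj.
  by apply: eq_from_tnth => j; rewrite !tnth_mktuple /= -tuple_eta.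
apply: eq_bigr => -[m v] _ /=; rewrite mulrA; congr (_ * Phi _).
  rewrite mulrC /mask_prob -big_split; apply: eq_bigr => j _.
  by rewrite !tnth_mktuple -/(mask_prob rho _) mask_prob_cons.
apply/funext => j; rewrite /extend !tnth_mktuple /=.
by case: (tnth v j).
Qed.

Lemma trace_mean_cat x y Phi :
  trace_mean (x ++ y) Phi = trace_mean y (trace_mean x Phi).
Proof. by elim: x Phi => //= b x IH Phi. Qed.

Lemma trace_mean_nseq n b Phi :
  trace_mean (nseq n b) Phi = iter n (average (@mask_prob R k rho) (extend b)) Phi.
Proof. by elim: n Phi => //= n IH Phi; rewrite IH -iterSr. Qed.

Lemma trace_mean_le x Phi b : (forall t, `|Phi t| <= b) ->
  forall t, `|trace_mean x Phi t| <= b.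
Proof.
elim: x Phi => //= c x IH Phi h; apply: IH.
by apply: average_le h; [exact: mask_prob_ge0 | exact: mask_prob_sum].
Qed.

Lemma trace_mean_average x (V : finType) (w : V -> R) (F : V -> ('I_k -> seq bool) -> R) t :
  trace_mean x (fun t' => \sum_v w v * F v t') t = \sum_v w v * trace_mean x (F v) t.
Proof.
elim: x F => //= b x IH F; rewrite -IH; congr (trace_mean x _ t).
apply/funext => t'; rewrite /average.
under eq_bigr do rewrite mulr_sumr.
rewrite exchange_big; apply: eq_bigr => v _; rewrite mulr_sumr.
by apply: eq_bigr => v' _; rewrite mulrCA.
Qed.

Definition unsampled : R := (1 - rho) ^+ k.

(** Union bound: the value at [t] changes only if some symbol of [x] is retained in some trace. *)
Lemma trace_mean_near x Phi : (forall t, 0 <= Phi t <= 1) ->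
  forall t, `|trace_mean x Phi t - Phi t| <= (size x)%:R * (1 - unsampled).
Proof.
elim: x Phi => [|b x IH] Phi h t /=; first by rewrite subrr normr0 mul0r.
set Psi := average _ _ _.
have hw := @mask_prob_ge0 k; have hs := mask_prob_sum k.
have P1 t' : 0 <= Psi t' <= 1.
  apply/andP; split.
    by apply: sumr_ge0 => v _; rewrite mulr_ge0 //; case/andP: (h (extend b v t')).
  rewrite -hs; apply: ler_sum => v _; rewrite ler_piMr //.
  by case/andP: (h (extend b v t')).
rewrite -(subrKA (Psi t)); apply: le_trans (ler_normD _ _) _.
rewrite -natr1 mulrDl mul1r; apply: lerD; first exact: IH.
rewrite /Psi /average /unsampled -mask_prob_none.
set v0 : k.-tuple bool := [tuple of nseq k false].
have e0 : extend b v0 t = t by apply/funext => j; rewrite /extend tnth_nseq.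
have -> : 1 - mask_prob rho v0 = \sum_(v | v != v0) mask_prob rho v.
  by rewrite -[in LHS]hs (bigD1 v0) //= addrAC subrr add0r.
rewrite -[X in _ - X]mul1r -[X in _ - X * _]hs mulr_suml -sumrB (bigD1 v0) //=.
rewrite e0 subrr add0r.
apply: le_trans (ler_norm_sum _ _ _) _; apply: ler_sum => v _.
rewrite -mulrBr normrM ger0_norm // ler_piMr //.
by have := h (extend b v t); have := h t; rewrite ler_norml; lra.
Qed.

(* Moving a symbol of the padding into the cell between [u] and [y] changes
   nothing unless one of the k traces retains it. *)
Lemma trace_mean_newton u y H P Phi : (H <= P)%N -> (forall t, `|Phi t| <= 1) ->
  exists X : nat -> R, (forall s, `|X s| <= (2 * (1 - unsampled)) ^+ s) /\
    forall l, (l <= H)%N ->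
      trace_mean (u ++ nseq l true ++ y ++ nseq (P - l) false) Phi (fun=> [::]) =
      \sum_(s < H.+1) 'C(l, s)%:R * X s.
Proof.
move=> HP hPhi.
(* A state keeps apart what the traces retain of the ones of the cell and of the padding. [al] feeds
   the former and [be] the latter, so they commute. *)
pose S := (('I_k -> seq bool) * ('I_k -> seq bool))%type.
pose al v (z : S) : S := (extend true v z.1, z.2).
pose be v (z : S) : S := (z.1, extend false v z.2).
pose w := @mask_prob R k rho.
pose G := trace_mean u Phi.
pose f (z : S) := trace_mean y (fun t => G (fun j => z.1 j ++ t j)) z.2.
have fb z : `|f z| <= 1 by apply: trace_mean_le => t; apply: trace_mean_le.
pose v0 : k.-tuple bool := [tuple of nseq k false].
have al0 z : al v0 z = be v0 z.
  case: z => z1 z2; rewrite /al /be /=.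
  by congr pair; apply/funext => j; rewrite /extend tnth_nseq.
have [X [X1 X2]] := average_newton_bounded (@mask_prob_ge0 k)
  (mask_prob_sum k) al0 (fun v v' z => erefl) (fun=> [::], fun=> [::]) HP fb.
exists X; split=> [s|l /X2 <-]; first by have := X1 s; rewrite mask_prob_none.
rewrite !trace_mean_cat !trace_mean_nseq -/G -/w.
(* Adding ones in front of the traces of [y] commutes with averaging over these traces. *)
have alE n z : iter n (average w al) f z =
    trace_mean y (fun t => iter n (average w (extend true)) G (fun j => z.1 j ++ t j)) z.2.
  elim: n z => [|n IH] z //; rewrite iterS {1}/average.
  under eq_bigr do rewrite IH.
  rewrite -trace_mean_average; congr (trace_mean y _ _); apply/funext => t.
  rewrite iterS {1}/average; apply: eq_bigr => v _; congr (_ * _).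
  have -> : extend true v (fun j => z.1 j ++ t j) = (fun j => (al v z).1 j ++ t j).
    by apply/funext => j; rewrite /= /extend; case: (tnth v j).
  by [].
have beE n F z : iter n (average w be) F z =
    iter n (average w (extend false)) (fun t => F (z.1, t)) z.2.
  elim: n z => [|n IH] z; first by case: z.
  by rewrite iterS {1}/average iterS {1}/average; apply: eq_bigr => v _; rewrite IH.
rewrite iter_averageC // beE /=; congr (iter _ _ _ _); apply/funext => t.
by rewrite alE /=.
Qed.

End Traces.

(** * Moment matching *)

Section MomentMatching.

Variable R : realFieldType.

(** Pascal's rule: a difference of order [n + 1] is the difference of order [n] of the first
    differences. *)
Lemma alternating_bin_sumS n (f : nat -> R) :
  \sum_(i < n.+2) (-1) ^+ i * 'C(n.+1, i)%:R * f i =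
  \sum_(i < n.+1) (-1) ^+ i * 'C(n, i)%:R * (f i - f i.+1).
Proof.
under [RHS]eq_bigr do rewrite mulrBr.
rewrite sumrB big_ord_recl [in RHS]big_ord_recl /= !bin0 -addrA.
congr (_ + _).
have -> : \sum_(i < n) (-1) ^+ bump 0 i * 'C(n, bump 0 i)%:R * f (bump 0 i) =
    \sum_(i < n.+1) (-1) ^+ i.+1 * 'C(n, i.+1)%:R * f i.+1.
  by rewrite big_ord_recr /= bin_small // mulr0 mul0r addr0.
rewrite -sumrB; apply: eq_bigr => i _; rewrite /bump /= add1n binS natrD exprS.
by ring.
Qed.

(** Translation by 1 preserves the leading coefficient, so each first difference lowers the
    degree. *)
Lemma alternating_bin_poly n (p : {poly R}) : (size p <= n)%N ->
  \sum_(i < n.+1) (-1) ^+ i * 'C(n, i)%:R * p.[i%:R] = 0.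
Proof.
elim: n p => [|n IH] p sp.
  move: sp; rewrite leqn0 size_poly_eq0 => /eqP ->.
  by rewrite big1 // => i _; rewrite horner0 mulr0.
rewrite (alternating_bin_sumS n (fun i => p.[i%:R])).
pose X1 : {poly R} := 'X + 1%:P.
have sX1 : size X1 = 2%N by rewrite /X1 size_XaddC.
have sc : size (p \Po X1) = size p by apply: size_comp_poly2.
rewrite -[RHS](IH (p - (p \Po X1))).
  apply: eq_bigr => i _.
  by rewrite hornerD hornerN horner_comp hornerD hornerX hornerC natr1.
apply/leq_sizeP => j nj; rewrite coefB.
have [pj|jp] := leqP (size p) j.
  by rewrite !nth_default ?subrr // sc.
have jE : j = (size p).-1 by lia.
rewrite [p`_j]/(p`_j) jE -{2}sc -!lead_coefE lead_coef_comp ?sX1 //.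
by rewrite /X1 lead_coefXaddC expr1n mulr1 subrr.
Qed.

Lemma poly_divide_root (p : {poly R}) c :
  exists2 q : {poly R}, (size q <= (size p).-1)%N &
    forall x, p.[x] = p.[c] + (x - c) * q.[x].
Proof.
have /factor_theorem [q E] : root (p - p.[c]%:P) c.
  by rewrite /root hornerD hornerN hornerC subrr.
exists q => [|x]; last first.
  have := congr1 (fun r => r.[x]) E.
  by rewrite hornerD hornerN hornerC hornerM hornerXsubC => h; rewrite mulrC -h; ring.
have [->|q0] := eqVneq q 0; first by rewrite size_poly0.
have : (size (q * ('X - c%:P))%R <= size p)%N.
  rewrite -E; apply: leq_trans (size_polyD _ _) _; rewrite size_polyN geq_max leqnn /=.
  have [p0|p0] := eqVneq p 0; first by rewrite p0 horner0 size_poly0.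
  by rewrite (leq_trans (size_polyC_leq1 _)) // size_poly_gt0.
by rewrite size_Mmonic ?monicXsubC // size_XsubC addn2 /=; case: (size p).
Qed.

(** Right of the middle, ratios of consecutive coefficients are at most 1; symmetry gives the left
    half. *)
Lemma central_bin_max m i : ('C(m.*2, i) <= 'C(m.*2, m))%N.
Proof.
have H j : ('C(m.*2, m + j) <= 'C(m.*2, m))%N.
  elim: j => [|j IH]; first by rewrite addn0.
  apply: leq_trans IH; rewrite addnS.
  have := mul_bin_left m.*2 (m + j).
  have : (m.*2 - (m + j) <= (m + j).+1)%N by lia.
  set c := 'C(_, _.+1); set d := 'C(_, _); set b := subn _ _ => bj E.
  rewrite -(@leq_pmul2l (m + j).+1) // E leq_mul2r bj orbT //.
have [im|mi] := leqP m i; first by rewrite -(subnKC im).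
have i2 : (i <= m.*2)%N by lia.
rewrite -bin_sub //; have -> : (m.*2 - i = m + (m - i))%N by lia.
exact: H.
Qed.

Lemma sum_inv_sq m : \sum_(j < m) (j.+1%:R ^+ 2 : R)^-1 <= 2.
Proof.
(* The sharper bound telescopes, since [1/x^2 <= 2/(x(x+1))] for [x >= 1]. *)
suff : \sum_(j < m) (j.+1%:R ^+ 2 : R)^-1 <= 2 - 2 / m.+1%:R.
  by move=> h; apply: le_trans h _; rewrite gerBl divr_ge0.
elim: m => [|m IH]; first by rewrite big_ord0 divr1 subrr.
rewrite big_ord_recr /=; apply: le_trans (lerD IH (lexx _)) _.
have : 1 <= (m.+1%:R : R) by rewrite ler1n.
rewrite -[in X in _ -> X](natr1 m.+1); move: (m.+1%:R : R) => x x1; have x0 : 0 < x by lra.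
have -> : 2 - 2 / (x + 1) = 2 - 2 / x + 2 / (x * (x + 1)) by field; apply/andP; split; apply: lt0r_neq0; lra.
rewrite lerD2l -[leLHS]mul1r ler_pdivrMr ?exprn_gt0 // mulrAC.
by rewrite ler_pdivlMr ?mulr_gt0 //; nra.
Qed.

(* One of the two truncated subtractions vanishes. *)
Definition dist2 (m i : nat) : nat := ((i - m) ^ 2 + (m - i) ^ 2)%N.

Lemma dist2E m i : (dist2 m i)%:R = (i%:R - m%:R) ^+ 2 :> R.
Proof.
rewrite /dist2 natrD !natrX; have [h|h] := leqP m i.
  by rewrite (eqP h) expr0n addr0 natrB.
by rewrite (eqP (ltnW h)) expr0n add0r natrB 1?ltnW // -sqrrN opprB.
Qed.

Lemma dist2_le m i : (i < m.*2.+1)%N -> (dist2 m i <= m ^ 2)%N.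
Proof.
rewrite /dist2 => im; have [h|h] := leqP i m.
  by rewrite (eqP h) leq_exp2r // leq_subr.
rewrite (eqP (ltnW h)) addn0 leq_exp2r //; lia.
Qed.

(** The central term is 1, and the factor 16 shrinks each side to at most [2/16]. *)
Lemma sum_inv_dist2 m :
  \sum_(i < m.*2.+1) (1 + 16 * (dist2 m i)%:R : R)^-1 <= 5 / 4.
Proof.
pose F i : R := (1 + 16 * (dist2 m i)%:R)^-1.
have half (G : nat -> R) : (forall j, G j <= (16 * j.+1%:R ^+ 2)^-1) ->
    \sum_(j < m) G j <= 1 / 8.
  move=> hG; apply: le_trans (ler_sum _ (fun (i : 'I_m) _ => hG i)) _.
  under eq_bigr do rewrite invfM.
  by rewrite -mulr_sumr; have := sum_inv_sq m; lra.
have Fle i j : dist2 m i = (j.+1 ^ 2)%N -> F i <= (16 * j.+1%:R ^+ 2)^-1.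
  move=> E; have h : 0 < (j.+1%:R ^+ 2 : R) by rewrite exprn_gt0.
  by rewrite /F E natrX lef_pV2 ?posrE; lra.
rewrite -(big_mkord xpredT F) (@big_cat_nat _ _ _ m) //=; last by lia.
rewrite big_nat_rev big_mkord [X in _ + X]big_ltn; last by lia.
rewrite -[m.+1 in X in _ + (_ + X)]add0n big_addn.
have -> : (m.*2.+1 - m.+1 = m)%N by lia.
rewrite big_mkord.
have h1 : \sum_(i < m) F (0 + m - i.+1)%N <= 1 / 8.
  have -> : \sum_(i < m) F (0 + m - i.+1)%N =
            \sum_(i < m) (if (i < m)%N then F (m - i.+1)%N else 0).
    by apply: eq_bigr => i _; rewrite ltn_ord add0n.
  apply: (half (fun j => if (j < m)%N then F (m - j.+1)%N else 0)) => j.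
  case: ifP => jm; last by rewrite invr_ge0 mulr_ge0 // exprn_ge0.
  apply: Fle; rewrite /dist2; have -> : (m - j.+1 - m = 0)%N by lia.
  by have -> : (m - (m - j.+1) = j.+1)%N by lia.
have h2 : \sum_(i < m) F (i + m.+1)%N <= 1 / 8.
  by apply: (half (fun j => F (j + m.+1)%N)) => j; apply: Fle;
    rewrite /dist2 addnS -addSn addnK (_ : m - (j.+1 + m) = 0)%N ?addn0 //; lia.
have -> : F m = 1 by rewrite /F /dist2 subnn mulr0 addr0 invr1.
by lra.
Qed.

(** Division of [p] by [x(x-1)] leaves a linear part, determined by the values at 0 and 1, and a
    quotient [q] of degree below [m]. On [q] the signed weights act as a difference of order [2m] in
    [i], which kills it because the support points are quadratic in [i]. *)
Lemma moment_matching (m : nat) :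
  exists (I : finType) (v : I -> nat) (mu0 mu1 : I -> R),
  [/\ forall i, 0 <= mu0 i, forall i, 0 <= mu1 i,
      \sum_i mu0 i = 1 & \sum_i mu1 i = 1] /\
  [/\ forall p : {poly R}, (size p <= m.+2)%N ->
        \sum_i mu0 i * p.[(v i)%:R] = \sum_i mu1 i * p.[(v i)%:R],
      forall i, (v i <= 1 + 200 * (1 + 16 * m ^ 2))%N,
      forall i, mu1 i != 0 -> (0 < v i)%N,
      \sum_i mu0 i * (v i != 0%N)%:R <= 1 / 100 &
      \sum_i mu1 i * (v i)%:R <= 2].
Proof.
(* Hiding the definition of [y] keeps numerals in unary from being unfolded. *)
have [y [y1 y_le y_gt0]] : exists y : nat -> nat,
    [/\ forall i, (y i)%:R - 1 = 200 * (1 + 16 * (dist2 m i)%:R) :> R,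
        forall i, (dist2 m i <= m ^ 2)%N -> (y i <= 1 + 200 * (1 + 16 * m ^ 2))%N
      & forall i, (0 < y i)%N].
  exists (fun i => (1 + 200 * (1 + 16 * dist2 m i))%N); split=> i; last by [].
    by rewrite natrD addrC addKr natrM natrD natrM.
  by move=> h; rewrite leq_add2l leq_mul2l leq_add2l leq_mul2l h.
(* Scaled so that the central weight is 1; the sign [chi] is positive there. *)
pose be i : R := 'C(m.*2, i)%:R / 'C(m.*2, m)%:R.
pose chi i : R := (-1) ^+ (i + m).
pose e i : R := be i / ((y i)%:R * ((y i)%:R - 1)).
pose n := m.*2.+1.
have cm0 : 0 < ('C(m.*2, m)%:R : R) by rewrite ltr0n bin_gt0; lia.
have be01 i : 0 <= be i <= 1.
  rewrite /be divr_ge0 ?ler0n //= ler_pdivrMr // mul1r ler_nat.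
  exact: central_bin_max.
have y1_ge i : 200 <= (y i)%:R - 1 :> R.
  by rewrite y1; have : 0 <= ((dist2 m i)%:R : R) by []; lra.
have e_ge0 i : 0 <= e i.
  have := y1_ge i; case/andP: (be01 i) => b0 _ yi.
  by rewrite /e divr_ge0 // mulr_ge0 //; lra.
have eyE i : e i * (y i)%:R = be i / ((y i)%:R - 1).
  by have := y1_ge i; rewrite /e => yi; field; apply/andP; split; apply: lt0r_neq0; lra.
have ey_le i : e i * (y i)%:R <= 1 / 200 * (1 + 16 * (dist2 m i)%:R)^-1.
  have h : 0 <= (1 + 16 * (dist2 m i)%:R : R)^-1.
    by rewrite invr_ge0 addr_ge0 // mulr_ge0.
  rewrite eyE y1 invfM mulrA ler_wpM2r //.
  by case/andP: (be01 i) => _; lra.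
have ebe i : e i * ((y i)%:R * ((y i)%:R - 1)) = be i.
  by have yi := y1_ge i; rewrite /e divfK // mulf_neq0 //; apply: lt0r_neq0; lra.
have sumey : \sum_(i < n) e i * (y i)%:R <= 1 / 160.
  apply: le_trans (ler_sum _ (fun (i : 'I_n) _ => ey_le i)) _.
  by rewrite -mulr_sumr; have := sum_inv_dist2 m; rewrite -/n; lra.
have sume : \sum_(i < n) e i <= 1 / 160 / 200.
  apply: (@le_trans _ _ (\sum_(i < n) 1 / 200 * (e i * (y i)%:R))).
    by apply: ler_sum => i _; have := y1_ge i; have := e_ge0 i; nra.
  by rewrite -mulr_sumr; lra.
pose od i := odd (i + m).
have chiE i : chi i = if od i then -1 else 1.
  by rewrite /chi -signr_odd -/(od i); case: (od i); rewrite ?expr1 ?expr0.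
(* The central term of [A] is [1/200]; the others total at most [1/160 - 1/200 = 1/800] in absolute
   value. *)
pose A := \sum_(i < n) chi i * (e i * (y i)%:R).
pose O := \sum_(i < n) (if od i then e i else 0).
pose E := \sum_(i < n) (if od i then 0 else e i).
have O_ge0 : 0 <= O by apply: sumr_ge0 => i _; case: ifP.
have E_ge0 : 0 <= E by apply: sumr_ge0 => i _; case: ifP.
have OE : E + O = \sum_(i < n) e i.
  by rewrite -big_split; apply: eq_bigr => i _ /=; case: ifP; rewrite ?addr0 ?add0r.
have mn : (m < n)%N by rewrite /n; lia.
have eym : e m * (y m)%:R = 1 / 200.
  rewrite eyE y1 /be divff ?gt_eqF //.
  have d0 : dist2 m m = 0%N by rewrite /dist2 subnn.
  by rewrite d0 mulr0 addr0 mulr1.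
have AE : A = 1 / 200 + \sum_(i < n | i != Ordinal mn) chi i * (e i * (y i)%:R).
  rewrite /A (bigD1 (Ordinal mn)) //=; congr (_ + _).
  by rewrite [e m * _]eym chiE /od addnn odd_double !mul1r.
have rest : \sum_(i < n | i != Ordinal mn) e i * (y i)%:R <= 1 / 800.
  have -> : \sum_(i < n | i != Ordinal mn) e i * (y i)%:R =
      \sum_(i < n) e i * (y i)%:R - 1 / 200.
    by rewrite [in RHS](bigD1 (Ordinal mn)) //= [e m * _]eym; lra.
  by lra.
have [A_ge A_le] : 3 / 800 <= A /\ A <= 5 / 800.
  have : `|\sum_(i < n | i != Ordinal mn) chi i * (e i * (y i)%:R)| <= 1 / 800.
    apply: le_trans (ler_norm_sum _ _ _) _; apply: le_trans rest.
    apply: ler_sum => i _; rewrite normrM.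
    have -> : `|chi i| = 1 by rewrite chiE; case: ifP => _; rewrite ?normrN1 ?normr1.
    by rewrite mul1r ger0_norm // mulr_ge0.
  by rewrite ler_norml AE => /andP[]; lra.
(* The common total mass of both laws: [(A - E + O) + E] for [mu0] and [A + O] for [mu1]. *)
pose Z := A + O.
have Z_ge : 3 / 800 <= Z by rewrite /Z; lra.
pose v (i : nat) : nat := if i is j.+1 then (if j is l.+1 then y l else 1%N) else 0%N.
(* Positive weights go to [mu0] and negative ones to [mu1]; the masses at 0 and 1 are forced by
   matching total mass and mean. *)
pose mu0 (i : nat) : R :=
  (if i is j.+1 then (if j is l.+1 then (if od l then 0 else e l) else 0)
   else A - E + O) / Z.
pose mu1 (i : nat) : R :=
  (if i is j.+1 then (if j is l.+1 then (if od l then e l else 0) else A)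
   else 0) / Z.
have Z_gt0 : 0 < Z by lra.
have Z0 : Z != 0 by rewrite gt_eqF.
have E_le : E <= 1 / 160 / 200 by lra.
have AEO_ge0 : 0 <= A - E + O by lra.
have A_ge0 : 0 <= A by lra.
have rec (F : nat -> R) : \sum_(i < n.+2) F i = F 0%N + (F 1%N + \sum_(i < n) F i.+2).
  by rewrite !big_ord_recl.
exists 'I_n.+2, (fun i : 'I_n.+2 => v i), (fun i : 'I_n.+2 => mu0 i),
  (fun i : 'I_n.+2 => mu1 i).
split; split.
- case=> [[|[|i]] hi]; rewrite /mu0 /=; apply: divr_ge0; try exact: ltW.
  + exact: AEO_ge0.
  + by [].
  + by case: ifP.
- case=> [[|[|i]] hi]; rewrite /mu1 /=; apply: divr_ge0; try exact: ltW.
  + by [].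
  + exact: A_ge0.
  + by case: ifP.
- rewrite rec /mu0 /= -mulr_suml -/E mul0r add0r -mulrDl -[RHS](divff Z0).
  by congr (_ / _); rewrite /Z; ring.
- rewrite rec /mu1 /= -mulr_suml -/O mul0r add0r -mulrDl -[RHS](divff Z0) //.
- move=> p sp.
  have [q1 sq1 E1] := poly_divide_root p 0.
  have [q sq E2] := poly_divide_root q1 1.
  have P x : p.[x] = p.[0] + x * (p.[1] - p.[0]) + x * (x - 1) * q.[x].
    by rewrite (E1 x) (E1 1) (E2 x); ring.
  (* The point [y i] is the value at [i] of a quadratic polynomial, so [q \Po Y] has degree below
     [2m]. *)
  pose Y : {poly R} := (1 + 200)%:P + (200 * 16) *: ('X - m%:R%:P) ^+ 2.
  have YE i : Y.[i%:R] = (y i)%:R.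
    rewrite /Y hornerD hornerC hornerZ horner_exp hornerXsubC -dist2E.
    by rewrite -[RHS](subrK 1) y1; ring.
  have kill : \sum_(i < n) chi i * be i * q.[(y i)%:R] = 0.
    have := @alternating_bin_poly m.*2 (q \Po Y) _.
    have sY : (size Y <= 3)%N.
      apply: leq_trans (size_polyD _ _) _; rewrite geq_max; apply/andP; split.
        exact: leq_trans (size_polyC_leq1 _) _.
      by apply: leq_trans (size_scale_leq _ _) _; rewrite size_exp_XsubC.
    move=> H; have : (size (q \Po Y) <= m.*2)%N.
      have [->|q0] := eqVneq q 0; first by rewrite comp_poly0 size_poly0.
      have sqm : (size q <= m)%N.
        by rewrite (leq_trans sq) // -subn1 leq_subLR (leq_trans sq1) //; move: sp; case: (size p).
      have q1' : (0 < size q)%N by rewrite size_poly_gt0.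
      apply: leq_trans (size_comp_poly_leq q Y) _.
      apply: (@leq_trans ((size q).-1 * 2).+1).
        by rewrite ltnS leq_mul2l; apply/orP; right; move: sY; case: (size Y).
      by rewrite muln2 ltn_double prednK.
    move/H => {}H; transitivity
      ((-1) ^+ m / 'C(m.*2, m)%:R *
       \sum_(i < n) (-1) ^+ i * 'C(m.*2, i)%:R * (q \Po Y).[i%:R]).
      rewrite mulr_sumr; apply: eq_bigr => i _.
      by rewrite horner_comp YE /chi /be exprD; ring.
    by rewrite H mulr0.
  suff key : (A - E + O) * p.[0] - A * p.[1] + \sum_(i < n) chi i * e i * p.[(y i)%:R] = 0.
    apply/eqP; rewrite -subr_eq0 (rec (fun i => mu0 i * p.[(v i)%:R]))
      (rec (fun i => mu1 i * p.[(v i)%:R])) /mu0 /mu1 /=; apply/eqP.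
    have pull (c : nat -> R) : \sum_(i < n) c i / Z * p.[(y i)%:R] =
        (\sum_(i < n) c i * p.[(y i)%:R]) / Z.
      by rewrite mulr_suml; apply: eq_bigr => i _; rewrite mulrAC.
    rewrite (pull (fun i => if od i then 0 else e i)).
    rewrite (pull (fun i => if od i then e i else 0)).
    have split : \sum_(i < n) chi i * e i * p.[(y i)%:R] =
        \sum_(i < n) (if od i then 0 else e i) * p.[(y i)%:R] -
        \sum_(i < n) (if od i then e i else 0) * p.[(y i)%:R].
      by rewrite -sumrB; apply: eq_bigr => i _; rewrite chiE; case: ifP => _; ring.
    rewrite split in key; move: key.
    move: (\sum_(i < n) _) (\sum_(i < n) _) => s1 s2 key.
    by rewrite -[RHS](mul0r Z^-1) -[in RHS]key; ring.
  have -> : \sum_(i < n) chi i * e i * p.[(y i)%:R] =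
      p.[0] * (E - O) + (p.[1] - p.[0]) * A + \sum_(i < n) chi i * be i * q.[(y i)%:R].
    rewrite /A /E /O -sumrB !mulr_sumr -!big_split; apply: eq_bigr => i _ /=.
    rewrite (P (y i)%:R) chiE -(ebe i); move: (y i)%:R => z.
    by case: ifP => _; ring.
  by rewrite kill; ring.
- by case=> [[|[|i]] hi] //=; apply: y_le; exact: dist2_le.
- by case=> [[|[|i]] hi] //=; rewrite /mu1 mul0r eqxx.
- rewrite (rec (fun i => mu0 i * (v i != 0%N)%:R)) /v /mu0 /= mulr0 mul0r mul0r !add0r.
  under eq_bigr do rewrite -lt0n y_gt0 mulr1.
  (* Here [E / Z <= (1/32000) / (3/800) = 1/120]. *)
  rewrite -mulr_suml -/E ler_pdivrMr //; lra.
- rewrite (rec (fun i => mu1 i * (v i)%:R)) /v /mu1 /= mulr0 add0r mulr1.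
  have -> : \sum_(i < n) (if od i then e i else 0) / Z * (y i)%:R =
      (\sum_(i < n) (if od i then e i * (y i)%:R else 0)) / Z.
    by rewrite mulr_suml; apply: eq_bigr => i _; case: ifP => _; ring.
  rewrite -mulrDl ler_pdivrMr //.
  (* The heavy central point has positive sign, so the sum runs within [rest]. *)
  have : \sum_(i < n) (if od i then e i * (y i)%:R else 0) <= 1 / 800.
    apply: le_trans rest; rewrite (bigD1 (Ordinal mn)) //= /od addnn odd_double add0r.
    by apply: ler_sum => i _; case: ifP => // _; rewrite mulr_ge0.
  rewrite /Z; lra.
Qed.

End MomentMatching.

(** * Binomial and factorial tail estimates *)

Section TailBounds.

Lemma bin_fact_le l s : ('C(l, s) * s`! <= l ^ s)%N.
Proof.
rewrite bin_ffact; elim: s => // s IH.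
by rewrite ffactnSr expnSr leq_mul // leq_subr.
Qed.

Lemma bin_le_expn n s : ('C(n, s) <= 2 ^ n)%N.
Proof.
elim: n s => [|n IH] [|s] //; first by rewrite bin0 expn_gt0.
by rewrite binS expnS mul2n -addnn leq_add.
Qed.

(** [s^s] is at most the falling factorial [(2s) ^_ s], which is ['C(2s, s) * s!]. *)
Lemma expn_self_le s : (s ^ s <= 4 ^ s * s`!)%N.
Proof.
have H j : (s ^ j <= (s + j) ^_ j)%N.
  elim: j => // j IH; rewrite expnS addnS ffactSS leq_mul //.
  by rewrite ltnW // ltnS leq_addr.
apply: leq_trans (H s) _; rewrite -bin_ffact leq_mul //.
have -> : (4 ^ s = 2 ^ (s + s))%N by rewrite addnn -mul2n (expnM 2 2 s).
exact: bin_le_expn.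
Qed.

Variable R : realFieldType.

(** By [expn_self_le] the left side is at most [(4x/s)^s <= 4^-s], and [2s >= D + s + 1]. *)
Lemma expr_fact_le (x : R) D s : 0 <= x -> 16 * x <= D%:R -> (D < s)%N ->
  x ^+ s / s`!%:R <= (2 ^- D * 2 ^- s.+1).
Proof.
move=> x0 xD Ds.
have f0 : 0 < (s`!%:R : R) by rewrite ltr0n fact_gt0.
apply: (@le_trans _ _ (4 ^- s)); last first.
  have -> : (4 : R) = 2 ^+ 2 by rewrite expr2 -natrM.
  rewrite -exprM -invfM -exprD lef_pV2 ?posrE ?exprn_gt0 //.
  by apply: ler_weXn2l; [rewrite ler1n | lia].
have hs : (s%:R ^+ s : R) <= 4 ^+ s * s`!%:R.
  by rewrite -!natrX -natrM ler_nat expn_self_le.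
have hx : (16 * x) ^+ s <= s%:R ^+ s.
  apply: lerXn2r; rewrite ?nnegrE ?mulr_ge0 //.
  by apply: le_trans xD _; rewrite ler_nat ltnW.
have p4 : 0 < (4 : R) ^+ s by rewrite exprn_gt0.
rewrite ler_pdivrMr // -(ler_pM2l p4) mulrA divff ?gt_eqF // mul1r.
rewrite -(ler_pM2l p4); apply: le_trans hs.
apply: le_trans hx; rewrite exprMn mulrA.
have -> : (16 : R) = 4 * 4 by rewrite -natrM.
by rewrite exprMn.
Qed.

Lemma sum_half_le n : \sum_(s < n) (2 : R) ^- s.+1 <= 1.
Proof.
suff -> : \sum_(s < n) (2 : R) ^- s.+1 = 1 - 2 ^- n.
  by rewrite gerBl invr_ge0 exprn_ge0.
elim: n => [|n IH]; first by rewrite big_ord0 expr0 invr1 subrr.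
rewrite big_ord_recr /= IH exprS invfM.
by move: (2 ^- n) => t; field.
Qed.

Lemma bin_poly (a s : nat) : exists2 p : {poly R}, (size p <= s.+1)%N &
  forall x : nat, p.[x%:R] = 'C(a * x, s)%:R.
Proof.
exists ((s`!%:R)^-1 *: \prod_(i < s) (a%:R *: 'X - i%:R%:P)).
  apply: leq_trans (size_scale_leq _ _) _.
  elim: s => [|s IH]; first by rewrite big_ord0 size_poly1.
  rewrite big_ord_recr /=; apply: leq_trans (size_polyMleq _ _) _.
  have : (size (a%:R *: 'X - s%:R%:P : {poly R})%R <= 2)%N.
    apply: leq_trans (size_polyD _ _) _; rewrite geq_max size_polyN; apply/andP; split.
      by apply: leq_trans (size_scale_leq _ _) _; rewrite size_polyX.
    exact: leq_trans (size_polyC_leq1 _) _.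
  by move: IH; case: (size _) => [|u]; case: (size _) => [|v] //; lia.
move=> x; rewrite hornerZ horner_prod.
have f0 : (s`!%:R : R) != 0 by rewrite pnatr_eq0 -lt0n fact_gt0.
apply: (mulfI f0); rewrite mulrA divff // mul1r mulrC -natrM bin_ffact.
elim: s {f0} => [|s IH]; first by rewrite big_ord0 ffactn0.
rewrite big_ord_recr /= IH hornerD hornerN hornerZ hornerX hornerC -natrM.
(* Truncated subtraction deviates from the true one only where the falling factorial has already
   vanished. *)
rewrite ffactnSr [in RHS]natrM; have [h|h] := leqP s (a * x)%N; first by rewrite natrB.
by rewrite ffact_small // !mul0r.
Qed.

(* Expanding in binomials, moment matching removes the terms of degree at most
   [D]; the rest is an exponential tail. *)
Lemma moment_gap (I : finType) (v : I -> nat) (mu0 mu1 : I -> R)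
    (a h D : nat) (y : R) (X : nat -> R) :
  (forall i, 0 <= mu0 i) -> (forall i, 0 <= mu1 i) ->
  \sum_i mu0 i = 1 -> \sum_i mu1 i = 1 ->
  (forall p : {poly R}, (size p <= D.+1)%N ->
     \sum_i mu0 i * p.[(v i)%:R] = \sum_i mu1 i * p.[(v i)%:R]) ->
  (forall i, (v i <= h)%N) -> 0 <= y -> (forall s, `|X s| <= y ^+ s) ->
  16 * (y * (a * h)%:R) <= D%:R ->
  `|\sum_i (mu0 i - mu1 i) * \sum_(s < (a * h).+1) 'C(a * v i, s)%:R * X s|
    <= 2 * 2 ^- D.
Proof.
move=> p0 p1 s0 s1 mm vh y0 Xy yD; set H := (a * h)%N.
under eq_bigr do rewrite mulr_sumr.
rewrite exchange_big /=; apply: le_trans (ler_norm_sum _ _ _) _.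
apply: (@le_trans _ _ (\sum_(s < H.+1) 2 * 2 ^- D * (2 : R) ^- s.+1)); last first.
  by rewrite -mulr_sumr ler_piMr ?sum_half_le // mulr_ge0 // invr_ge0 exprn_ge0.
apply: ler_sum => s _.
have -> : \sum_i (mu0 i - mu1 i) * ('C(a * v i, s)%:R * X s) =
    X s * (\sum_i mu0 i * 'C(a * v i, s)%:R - \sum_i mu1 i * 'C(a * v i, s)%:R).
  by rewrite -sumrB mulr_sumr; apply: eq_bigr => i _; ring.
have [sD|Ds] := leqP s D.
  have [p sp pE] := bin_poly a s.
  under eq_bigr do rewrite -pE.
  under [X in _ - X]eq_bigr do rewrite -pE.
  rewrite mm; last exact: leq_trans sp _.
  by rewrite subrr mulr0 normr0 !mulr_ge0 // ?invr_ge0 ?exprn_ge0.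
have f0 : 0 < (s`!%:R : R) by rewrite ltr0n fact_gt0.
have avg (mu : I -> R) : (forall i, 0 <= mu i) -> \sum_i mu i = 1 ->
    0 <= \sum_i mu i * 'C(a * v i, s)%:R <= H%:R ^+ s / s`!%:R.
  move=> p1' s1'; rewrite sumr_ge0 /= => [|i _]; last by rewrite mulr_ge0.
  rewrite -[leRHS]mul1r -[X in _ <= X * _]s1' mulr_suml; apply: ler_sum => i _.
  rewrite ler_wpM2l // ler_pdivlMr // -natrM -natrX ler_nat.
  by apply: leq_trans (bin_fact_le _ _) _; rewrite leq_exp2r ?leq_mul2l ?vh ?orbT //; lia.
have /andP[a0 b0] := avg _ p0 s0; have /andP[a1 b1] := avg _ p1 s1.
have tail := expr_fact_le (mulr_ge0 y0 (ler0n _ H)) yD Ds.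
rewrite normrM; apply: (@le_trans _ _ (y ^+ s * (2 * (H%:R ^+ s / s`!%:R)))).
  apply: ler_pM => //; rewrite ler_norml; move: a0 b0 a1 b1.
  by move: (\sum_i _) (\sum_i _) (_ / _) => u w t; lra.
move: tail; rewrite exprMn; move: (y ^+ s) (H%:R ^+ s) (s`!%:R^-1) => u w t.
by move: (2 ^- D) (2 ^- s.+1) => d e; lra.
Qed.

End TailBounds.

(** * Replacing the laws of the cells one by one *)

Section Expectation.

Variables (R : realFieldType) (I : finType).
Implicit Types (mu : I -> R) (F G : seq I -> R).

Fixpoint expect mu (M : nat) F : R :=
  if M is M'.+1 then \sum_i mu i * expect mu M' (fun t => F (i :: t)) else F [::].

(** Comparing only on the support is what later brings in that [mu1] charges positive values
    only. *)
Lemma expect_le mu M F G : (forall i, 0 <= mu i) ->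
  (forall t, size t = M -> all (fun i => mu i != 0) t -> F t <= G t) ->
  expect mu M F <= expect mu M G.
Proof.
move=> p; elim: M F G => [|M IH] F G h /=; first exact: h.
apply: ler_sum => i _; have [->|mi] := eqVneq (mu i) 0; first by rewrite !mul0r.
by rewrite ler_wpM2l //; apply: IH => t st at_; apply: h => /=; rewrite ?st ?mi.
Qed.

Lemma expectD mu M F G :
  expect mu M (fun t => F t + G t) = expect mu M F + expect mu M G.
Proof.
elim: M F G => [|M IH] F G //=.
by rewrite -big_split; apply: eq_bigr => i _; rewrite IH mulrDr.
Qed.

Lemma expectZ mu M c F : expect mu M (fun t => c * F t) = c * expect mu M F.
Proof.
elim: M F => [|M IH] F //=.
by rewrite mulr_sumr; apply: eq_bigr => i _; rewrite IH mulrCA.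
Qed.

Lemma expect_sum mu M (J : finType) (c : J -> R) (F : J -> seq I -> R) :
  expect mu M (fun t => \sum_j c j * F j t) = \sum_j c j * expect mu M (F j).
Proof.
elim: M F => [|M IH] F //=.
under eq_bigr do rewrite IH mulr_sumr.
rewrite exchange_big; apply: eq_bigr => j _; rewrite mulr_sumr.
by apply: eq_bigr => i _; rewrite mulrCA.
Qed.

Lemma expect_cst mu M c : \sum_i mu i = 1 -> expect mu M (fun=> c) = c.
Proof. by move=> s; elim: M => //= M ->; rewrite -mulr_suml s mul1r. Qed.

Lemma expect_additive mu M (f : I -> R) : \sum_i mu i = 1 ->
  expect mu M (fun t => \sum_(i <- t) f i) = M%:R * \sum_i mu i * f i.
Proof.
move=> s; elim: M => [|M IH] /=; first by rewrite big_nil mul0r.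
under eq_bigr => i _.
  have -> : (fun t => \sum_(j <- i :: t) f j) = (fun t => f i + \sum_(j <- t) f j).
    by apply/funext => t; rewrite big_cons.
  rewrite expectD expect_cst // IH mulrDr; over.
by rewrite big_split /= -mulr_suml s mul1r -natr1 mulrDl mul1r addrC.
Qed.

Lemma expect_multiplicative mu M (q : I -> R) :
  expect mu M (fun t => \prod_(i <- t) q i) = (\sum_i mu i * q i) ^+ M.
Proof.
elim: M => [|M IH] /=; first by rewrite big_nil.
under eq_bigr => i _.
  have -> : (fun t => \prod_(j <- i :: t) q j) = (fun t => q i * \prod_(j <- t) q j).
    by apply/funext => t; rewrite big_cons.
  rewrite expectZ IH mulrA; over.
by rewrite -mulr_suml exprS.
Qed.

(* Lindeberg-style replacement, one coordinate at a time. *)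
Lemma expect_swap mu0 mu1 M F (eta kappa Q : R) (q : I -> R) :
  (forall i, 0 <= mu0 i) -> (forall i, 0 <= mu1 i) ->
  \sum_i mu0 i = 1 -> \sum_i mu1 i = 1 ->
  0 <= kappa -> (forall i, 0 <= q i) -> 1 <= Q ->
  \sum_i mu0 i * q i <= Q -> \sum_i mu1 i * q i <= Q ->
  (forall s1 s2, (size s1 + size s2).+1 = M ->
     `|\sum_i (mu0 i - mu1 i) * F (s1 ++ i :: s2)| <=
     eta + kappa * (\prod_(i <- s1) q i * \prod_(i <- s2) q i)) ->
  `|expect mu0 M F - expect mu1 M F| <= M%:R * (eta + kappa * Q ^+ M).
Proof.
move=> p0 p1 s0 s1 k0 qp Q1 Q0m Q1m.
elim: M F kappa k0 => [|M IH] F kappa k0 h; first by rewrite /= subrr normr0 mul0r.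
have QM : 0 <= Q ^+ M by rewrite exprn_ge0 //; lra.
rewrite /=.
(* Hybrid: the law of the tail is exchanged while the head follows [mu0], then that of the head
   while the tail follows [mu1]. *)
have -> : \sum_i mu0 i * expect mu0 M (fun t => F (i :: t)) -
    \sum_i mu1 i * expect mu1 M (fun t => F (i :: t)) =
    \sum_i mu0 i * (expect mu0 M (fun t => F (i :: t)) -
                    expect mu1 M (fun t => F (i :: t))) +
    expect mu1 M (fun t => \sum_i (mu0 i - mu1 i) * F (i :: t)).
  rewrite expect_sum -sumrB -big_split; apply: eq_bigr => i _ /=; ring.
apply: le_trans (ler_normD _ _) _.
rewrite -natr1 mulrDl mul1r; apply: lerD.
  apply: le_trans (ler_norm_sum _ _ _) _.
  apply: (@le_trans _ _ (\sum_i mu0 i * (M%:R * (eta + kappa * q i * Q ^+ M)))).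
    apply: ler_sum => i _; rewrite normrM ger0_norm // ler_wpM2l //.
    (* The factor [q i] of the head is absorbed into [kappa], which the induction leaves free. *)
    apply: IH => [|t1 t2 st]; first by rewrite mulr_ge0.
    have := h (i :: t1) t2; rewrite /= big_cons => /(_ _)/le_trans; apply.
      by rewrite addSn st.
    by rewrite !mulrA.
  have -> : \sum_i mu0 i * (M%:R * (eta + kappa * q i * Q ^+ M)) =
     M%:R * (eta * \sum_i mu0 i + kappa * Q ^+ M * \sum_i mu0 i * q i).
    rewrite !mulr_sumr -big_split mulr_sumr; apply: eq_bigr => i _ /=; ring.
  by rewrite s0 mulr1 ler_wpM2l // lerD2l exprSr mulrA ler_wpM2l // mulr_ge0.
have bnd t : size t = M -> `|\sum_i (mu0 i - mu1 i) * F (i :: t)| <=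
    eta + kappa * \prod_(i <- t) q i.
  by move=> st; have := h [::] t; rewrite /= big_nil mul1r add0n st; apply.
have E : expect mu1 M (fun t => eta + kappa * \prod_(i <- t) q i) <=
    eta + kappa * Q ^+ M.+1.
  rewrite expectD expect_cst // expectZ expect_multiplicative lerD2l ler_wpM2l //.
  apply: (@le_trans _ _ (Q ^+ M)).
    apply: lerXn2r; rewrite ?nnegrE //; last by lra.
    by apply: sumr_ge0 => i _; rewrite mulr_ge0.
  by rewrite exprS ler_peMl.
rewrite ler_norml; apply/andP; split.
  rewrite lerNl; apply: le_trans E; rewrite -mulN1r -expectZ; apply: expect_le => // t st _.
  by rewrite mulN1r; have := bnd t st; rewrite ler_norml => /andP[]; lra.
apply: le_trans E; apply: expect_le => // t st _.
by have := bnd t st; rewrite ler_norml => /andP[].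
Qed.

End Expectation.

(** * Hard strings and testers *)

Definition word (N a : nat) (s : seq nat) : seq bool :=
  cells a s ++ nseq (N - size (cells a s)) false.

Lemma size_word N a s : (size (cells a s) <= N)%N -> size (word N a s) = N.
Proof. by move=> h; rewrite /word size_cat size_nseq subnKC. Qed.

Lemma word_tuple N a s : (size (cells a s) <= N)%N ->
  exists X : N.-tuple bool, tval X = word N a s.
Proof. by move=> /size_word/eqP h; exists (Tuple h). Qed.

Lemma word_few_blocks N a s n (X : N.-tuple bool) : tval X = word N a s ->
  (2 * count (predC1 0%N) s < n)%N -> X \in block_strings N n.
Proof.
move=> E h; rewrite inE; apply: leq_trans h.
by apply: leq_trans (card_blocks_le X false) _; rewrite ltnS E changes_cells.
Qed.

(** A common subsequence with an [n]-block string has at most [n] ascents, so at least [3n] of the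
    [4n] cells lose [a] symbols each. The relative distance thus exceeds [3na / (80na) > 1/40]. *)
Lemma word_far (R : realType) (eps : R) N a s n (X : N.-tuple bool) :
  tval X = word N a s -> (size (cells a s) <= N)%N -> all (leq a) s ->
  size s = (4 * n)%N -> (0 < n)%N -> (0 < a)%N -> (N < 80 * (n * a))%N ->
  eps <= 1 / 40 ->
  X \in far_rel_edit eps (block_strings N n).
Proof.
move=> E hs al ss n0 a0 Na eps40; rewrite inE /dist_rel_edit.
apply: lt_bigmin => [|y]; first exact: ltry.
rewrite inE lte_fin => yn.
have [z [zx zy sz]] := ed_lcs X y.
rewrite E /word in zx; have h := ascents_cells al zx.
rewrite -/(word N a s) (size_word hs) ss in h; rewrite E (size_word hs) in sz.
have az : (ascents true z <= n)%N.
  apply: leq_trans (ascents_changes _ _) _.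
  apply: leq_trans (changes_subseq true zy) _.
  exact: leq_trans (card_blocks_ge y true) yn.
have ed_ge : (3 * (n * a) <= ed X y)%N.
  have : (a * ascents true z <= a * n)%N by rewrite leq_mul2l az orbT.
  by rewrite E; move: h sz; lia.
have N0 : (0 < N)%N.
  by apply: leq_trans hs; rewrite size_cells ss addn_gt0 !muln_gt0 a0 n0.
rewrite /d_rel_edit !size_tuple natrD.
have N0' : 0 < (N%:R : R) by rewrite ltr0n.
have -> : 2 / (N%:R + N%:R) * (ed X y)%:R = (ed X y)%:R / N%:R :> R.
  by field; apply/andP; split; apply: lt0r_neq0; lra.
apply: le_lt_trans eps40 _; rewrite ltr_pdivlMr //.
have : (N%:R : R) < 80 * (n * a)%:R by rewrite -natrM ltr_nat.
have : 3 * ((n * a)%:R : R) <= (ed X y)%:R by rewrite -natrM ler_nat.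
have : 0 < ((n * a)%:R : R) by rewrite ltr0n muln_gt0 n0.
by move: ((n * a)%:R) => u; lra.
Qed.

(** * Numerical estimates *)

Section Bounds.

Variable R : realType.

Lemma expR_half_le : expR (1 / 2 : R) <= 2.
Proof.
have h := expR_ge1Dx (- (1 / 2) : R); rewrite expRN in h.
have e0 : 0 < expR (1 / 2 : R) := expR_gt0 _.
by have := ler_wpM2r (ltW e0) h; rewrite mulVf ?gt_eqF //; lra.
Qed.

(** With [l] the truncated logarithm, [expR (l/2) <= 2^l <= n]. *)
Lemma trunc_log_le_ln (n : nat) : (0 < n)%N ->
  (trunc_log 2 n)%:R <= 2 * ln (n%:R : R).
Proof.
move=> n0; set l := trunc_log 2 n.
have h : expR (l%:R * (1 / 2)) <= n%:R :> R.
  rewrite expRM_natl; apply: (@le_trans _ _ (2 ^+ l)).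
    by apply: lerXn2r; rewrite ?nnegrE ?expR_ge0 // expR_half_le.
  by rewrite -natrX ler_nat trunc_logP.
rewrite -ler_ln ?posrE ?expR_gt0 ?ltr0n // expRK in h.
lra.
Qed.

(** From 10 on, a unit step multiplies the cube by at most [4/3], hence the sixth power by
    [16/9 < 2]. *)
Lemma sixth_power_le (l : nat) :
  ((l + 10)%:R : R) ^+ 6 <= 10 ^+ 6 * 2 ^+ l.
Proof.
elim: l => [|l IH]; first by rewrite expr0 mulr1.
rewrite (exprS 2 l) mulrCA; apply: le_trans (ler_wpM2l _ IH) => //.
rewrite addSn -natr1; have : 10 <= ((l + 10)%:R : R) by rewrite ler_nat leq_addl.
move: ((l + 10)%:R : R) => x x10 {IH}.
have x3 : (x + 1) ^+ 3 <= 4 / 3 * x ^+ 3 by nra.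
have x30 : 0 <= x ^+ 3 by rewrite exprn_ge0 //; lra.
have y30 : 0 <= (x + 1) ^+ 3 by rewrite exprn_ge0 //; lra.
rewrite -[6%N]/(3 * 2)%N !exprM; move: (x ^+ 3) ((x + 1) ^+ 3) x3 x30 y30 => u w.
by rewrite !expr2; nra.
Qed.

(** The offset 10 yields [512 n <= 2 ^ degree n] and fits [sixth_power_le]. *)
Definition degree (n : nat) : nat := (trunc_log 2 n + 10)%N.
(** The bound on the support in [moment_matching] for [m = degree n]. *)
Definition spread (n : nat) : nat := (1 + 200 * (1 + 16 * degree n ^ 2))%N.

Lemma spread_le n : ((spread n)%:R : R) <= 201 * 17 * (degree n)%:R ^+ 2.
Proof.
rewrite /spread natrD natrM natrD natrM natrX.
have : 1 <= ((degree n)%:R : R) ^+ 2.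
  by rewrite -natrX ler1n expn_gt0 /degree addn_gt0 orbT.
by move: ((degree n)%:R ^+ 2) => u; lra.
Qed.

(** The left side is of order [log^6 n], at most a constant times [n]; the second factor [n] absorbs
    the constant. *)
Lemma spread_small : exists n0 : nat, forall n, (n0 <= n)%N ->
  5 * ((spread n)%:R : R) ^+ 3 <= n%:R ^+ 2.
Proof.
have [C C0 hC] : exists2 C : R, 0 <= C & forall n,
    ((spread n)%:R : R) <= C * (degree n)%:R ^+ 2.
  by exists (201 * 17); [exact: mulr_ge0 | exact: spread_le].
pose A : R := 5 * C ^+ 3 * 10 ^+ 6.
have A0 : 0 <= A by apply: mulr_ge0; [apply: mulr_ge0 |]; rewrite ?exprn_ge0.
exists (2 ^ Num.Def.archi_bound A)%N => n hn.
have n0 : (0 < n)%N by apply: leq_trans hn; rewrite expn_gt0.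
have lA : A <= 2 ^+ trunc_log 2 n.
  apply: (le_trans (ltW (archi_boundP A0))); rewrite -natrX ler_nat.
  apply: (leq_trans (trunc_log_max (isT : 1 < 2)%N hn)).
  exact/ltnW/ltn_expl.
have nl : 2 ^+ trunc_log 2 n <= n%:R :> R by rewrite -natrX ler_nat trunc_logP.
apply: (@le_trans _ _ (5 * (C * (degree n)%:R ^+ 2) ^+ 3)).
  rewrite ler_wpM2l // lerXn2r ?nnegrE ?hC //.
  by apply: mulr_ge0; rewrite // exprn_ge0.
rewrite exprMn -(exprM _ 2 3).
apply: (@le_trans _ _ (A * 2 ^+ trunc_log 2 n)).
  have -> t : A * t = 5 * (C ^+ 3 * (10 ^+ 6 * t)) by rewrite /A !mulrA.
  rewrite ler_wpM2l // ler_wpM2l ?exprn_ge0 //.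
  exact: (sixth_power_le (trunc_log 2 n)).
rewrite expr2; apply: ler_pM => //; exact: le_trans lA nl.
Qed.

(** The cubic term of the exponential suffices: for [z = 10n/h], [z^3 >= 5000 n], and
    [4n * 2 * 6 / (5000 n) < 1/100]. *)
Lemma chernoff_small (n h : R) : 0 < n -> 0 < h -> 5 * h ^+ 3 <= n ^+ 2 ->
  4 * n * expR (1 / 2 - 10 * n / h) <= 1 / 100.
Proof.
move=> n0 h0 hn; set z := 10 * n / h.
have z0 : 0 <= z by rewrite /z divr_ge0 ?mulr_ge0 // ltW.
have ez : z ^+ 3 / 6 <= expR z.
  by have := expR_ge1Dxn 2 z0; rewrite -[3`!]/6%N; lra.
have z3 : 5000 * n <= z ^+ 3.
  rewrite /z expr_div_n ler_pdivlMr ?exprn_gt0 // exprMn.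
  have -> : (10 : R) ^+ 3 = 1000 by ring.
  rewrite [n ^+ 3]exprS; move: (h ^+ 3) (n ^+ 2) hn => u w; nra.
have e0 := expR_gt0 z.
rewrite expRD expRN; have h2 := expR_half_le.
have e1 : 0 < expR (1 / 2 : R) := expR_gt0 _.
rewrite mulrA ler_pdivrMr //.
apply: (@le_trans _ _ (4 * n * 2)); first by rewrite ler_wpM2l //; lra.
lra.
Qed.

End Bounds.

(** * Acceptance probabilities of a given tester *)

Section Testers.

Variables (R : realType) (k N n : nat) (rho eps : R) (T : k.-tuple (seq bool) -> R).
Hypotheses (n2 : (2 <= n)%N) (N_ge : (40 * n <= N)%N) (rho01 : 0 <= rho <= 1).
Hypothesis eps40 : eps <= 1 / 40.
Hypothesis tester :
  trace_tester (block_strings N n) (far_rel_edit eps (block_strings N n))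
    rho (2 / 3) T.

(** The [4n] cells hold [4na] zeros and, the unscaled lengths having mean at most 2, on average at
    most [8na] ones: well below [40na <= N]. *)
Let a := (N %/ (40 * n))%N.
Let acceptance w := trace_mean rho w (fun t => T [tuple t j | j < k]) (fun=> [::]).

Let a_gt0 : (0 < a)%N.
Proof. by rewrite divn_gt0 //; lia. Qed.

Let a_le : (40 * (n * a) <= N)%N.
Proof. by rewrite mulnA [(_ * a)%N]mulnC leq_trunc_div. Qed.

Let N_lt : (N < 80 * (n * a))%N.
Proof.
have : (N < (40 * n) * a.+1)%N by rewrite mulnC ltn_ceil //; lia.
have : (n <= n * a)%N by rewrite leq_pmulr.
by rewrite mulnS -mulnA; lia.
Qed.

Let T01 t : 0 <= T t <= 1.
Proof. by case: tester => h _ _; exact: h. Qed.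

Let T_norm (t : 'I_k -> seq bool) : `|T [tuple t j | j < k]| <= 1.
Proof. by rewrite ger0_norm; case/andP: (T01 [tuple t j | j < k]). Qed.

Lemma acceptance_few s : (size (cells a s) <= N)%N ->
  (2 * count (predC1 0%N) s < n)%N -> 2 / 3 <= acceptance (word N a s).
Proof.
move=> hs hn; have [X E] := word_tuple hs.
case: tester => _ h _; have := h X (word_few_blocks E hn).
by rewrite accept_prob_trace_mean E.
Qed.

Lemma acceptance_far s : (size (cells a s) <= N)%N -> all (leq a) s ->
  size s = (4 * n)%N -> acceptance (word N a s) <= 1 / 3.
Proof.
move=> hs al ss; have [X E] := word_tuple hs.
case: tester => _ _ h; have n0 : (0 < n)%N by lia.
have := h X (word_far E hs al ss n0 a_gt0 N_lt eps40).
rewrite accept_prob_trace_mean E -/(acceptance _); lra.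
Qed.

(** The words with all lengths 0 and all lengths [a] have acceptance probabilities at least [1/3]
    apart, yet each is within [k rho N] of the verdict on empty traces. *)
Lemma samples_ge : 1 / 6 <= k%:R * rho * N%:R.
Proof.
have hs b : (b <= a)%N -> (size (cells a (nseq (4 * n) b)) <= N)%N.
  move=> ba; rewrite size_cells size_nseq sumn_nseq.
  have : (b * (4 * n) <= a * (4 * n))%N by rewrite leq_mul2r ba orbT.
  by move: a_le; lia.
have h0 := @acceptance_few (nseq (4 * n) 0%N) (hs _ (leq0n a)) _.
have h1 := @acceptance_far (nseq (4 * n) a) (hs _ (leqnn a)) _ _.
have {}h0 := h0 ltac:(by rewrite count_nseq /= mul0n muln0; lia).
have {}h1 := h1 ltac:(by rewrite all_nseq leqnn orbT) (size_nseq _ _).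
have near w : size w = N -> `|acceptance w - T [tuple [::] | j < k]| <= k%:R * rho * N%:R.
  move=> sw; have H := trace_mean_near rho01 w (fun t => T01 [tuple t j | j < k]) (fun=> [::]).
  apply: le_trans H _; rewrite sw [leRHS]mulrC ler_wpM2l //.
  exact: bernoulli.
have := near _ (size_word (hs _ (leq0n a))).
have := near _ (size_word (hs _ (leqnn a))).
by rewrite !ler_norml; lra.
Qed.

Let acceptance01 w : 0 <= acceptance w <= 1.
Proof.
(* Centring at [1/2] turns the range [[0, 1]] into a bound on the absolute value. *)
have c t : `|T [tuple t j | j < k] - 1 / 2| <= 1 / 2.
  by rewrite ler_norml; have := T01 [tuple t j | j < k]; lra.
have e : acceptance w = trace_mean rho w (fun t => T [tuple t j | j < k] - 1 / 2) (fun=> [::]) + 1 / 2.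
  suff E (F : ('I_k -> seq bool) -> R) t0 : trace_mean rho w F t0 =
      trace_mean rho w (fun t => F t - 1 / 2) t0 + 1 / 2 by exact: E.
  elim: w F => [|b w IH] F /=; first by rewrite subrK.
  rewrite IH; congr (trace_mean rho w _ t0 + _); apply/funext => t.
  rewrite averageB; congr (_ - _).
  by rewrite /average -mulr_suml mask_prob_sum !mul1r.
have := trace_mean_le rho01 w c (fun=> [::]).
by rewrite e ler_norml; lra.
Qed.

(** The second hypothesis is the tail condition of [moment_gap] for degree [degree n + 1], as
    [2 (1 - unsampled) <= 2 k rho]. The mean of [F] is then at least [2/3 - 17/100] under [mu0] and
    at most [1/3] under [mu1], while the two differ by at most [2/100]. *)
Lemma no_tester : 5 * ((spread n)%:R : R) ^+ 3 <= n%:R ^+ 2 ->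
  32 * (k%:R * rho) * (a * spread n)%:R <= (degree n).+1%:R -> False.
Proof.
set m := degree n; set h := spread n => hn samples.
have [I [v [mu0 [mu1 [[p0 p1 s0 s1] [mm vh v1 few mean1]]]]]] := moment_matching R m.
rewrite -[X in forall i, (v i <= X)%N]/h in vh.
have mean0 : \sum_i mu0 i * (v i)%:R <= 2.
  by have := mm 'X; rewrite size_polyX => /(_ isT); under eq_bigr do rewrite hornerX;
     under [in X in _ = X -> _]eq_bigr do rewrite hornerX; move=> ->.
pose M := (4 * n)%N.
pose len (t : seq I) := [seq (a * v i)%N | i <- t].
(* Set to 0 when the cells do not fit in length [N]. *)
pose F t := if (size (cells a (len t)) <= N)%N then acceptance (word N a (len t)) else 0.
have F01 t : 0 <= F t <= 1.
  by rewrite /F; case: ifP => _; [exact: acceptance01 | rewrite lexx ler01].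
have size_len t : size (cells a (len t)) = (a * (size t + \sum_(i <- t) v i))%N.
  rewrite size_cells size_map sumnE big_map mulnDr; congr addn.
  by rewrite big_distrr.
have h0 : (0 < h)%N by [].
(* Chernoff weights: [kappa] times the product of the [q i] is [expR ((a h + a M + a sum v - N) / (2
   a h))], at least 1 when [a h] further symbols would not fit. *)
pose q i := expR ((v i)%:R / (2 * h%:R) : R).
pose Q := expR (2 / h%:R : R).
pose kappa := expR (((a * h)%:R + (a * M)%:R - N%:R) / (2 * (a * h)%:R) : R).
have hR : 0 < (h%:R : R) by rewrite ltr0n.
have aR : 0 < (a%:R : R) by rewrite ltr0n.
have q0 i : 0 <= q i := expR_ge0 _.
have prodq t : \prod_(i <- t) q i = expR ((\sum_(i <- t) v i)%:R / (2 * h%:R)).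
  elim: t => [|i t IH]; first by rewrite !big_nil mul0r expR0.
  by rewrite !big_cons IH /q -expRD -mulrDl natrD.
have qQ (mu : I -> R) : (forall i, 0 <= mu i) -> \sum_i mu i = 1 ->
    \sum_i mu i * (v i)%:R <= 2 -> \sum_i mu i * q i <= Q.
  (* For [x] in [[0, 1]], [expR (x/2) <= 1 + x] because [(1 + x)(1 - x/2) >= 1]. *)
  move=> pm sm mm2; apply: le_trans (expR_ge1Dx _).
  apply: (@le_trans _ _ (\sum_i (mu i + (mu i * (v i)%:R) / h%:R))).
    apply: ler_sum => i _; rewrite -mulrA -{2}[mu i]mulr1 -mulrDr ler_wpM2l //.
    set x : R := (v i)%:R / h%:R.
    have x01 : 0 <= x <= 1 by rewrite divr_ge0 //= ler_pdivrMr // mul1r ler_nat.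
    have -> : q i = expR (x / 2) by rewrite /q /x; congr expR; field; exact: lt0r_neq0.
    have := expR_ge1Dx (- (x / 2)); rewrite expRN.
    have := expR_gt0 (x / 2); move: (expR (x / 2)) => e e0 he.
    have : (1 - x / 2) * e <= 1.
      by have := ler_wpM2r (ltW e0) he; rewrite mulVf ?gt_eqF.
    by move: x01 => /andP[]; nra.
  by rewrite big_split /= sm -mulr_suml lerD2l ler_wpM2r // invr_ge0 ltW.
have Q1 : 1 <= Q by rewrite -[leLHS]expR0 ler_expR divr_ge0 // ltW.
have overflow t : (N < a * M + a * \sum_(i <- t) v i + a * h)%N ->
    1 <= kappa * \prod_(i <- t) q i.
  move=> hN; rewrite prodq /kappa -expRD -[leLHS]expR0 ler_expR.
  have -> : ((a * h)%:R + (a * M)%:R - N%:R) / (2 * (a * h)%:R) +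
      (\sum_(i <- t) v i)%:R / (2 * h%:R) =
      ((a * h)%:R + (a * M)%:R - N%:R + a%:R * (\sum_(i <- t) v i)%:R) /
      (2 * (a * h)%:R) :> R.
    by rewrite !natrM; field; apply/andP; split; exact: lt0r_neq0.
  apply: divr_ge0; last exact: mulr_ge0.
  have : N%:R <= (a * M)%:R + (a * \sum_(i <- t) v i)%:R + (a * h)%:R :> R.
    by rewrite -!natrD ler_nat ltnW.
  by rewrite (natrM _ a (\sum_(i <- t) v i)%N); lra.
have swap : `|expect mu0 M F - expect mu1 M F| <=
    M%:R * (2 * 2 ^- m.+1 + kappa * Q ^+ M).
  apply: (@expect_swap _ _ _ _ _ _ _ _ _ q) => //; try exact: expR_ge0.
  - exact: qQ.
  - exact: qQ.
  move=> t1 t2 st.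
  rewrite -big_cat; set S := (\sum_(i <- t1 ++ t2) v i)%N.
  have tail0 : 0 <= (2 * 2 ^- m.+1 : R) by rewrite mulr_ge0 // invr_ge0 exprn_ge0.
  have kq0 : 0 <= kappa * \prod_(i <- t1 ++ t2) q i.
    by rewrite mulr_ge0 ?expR_ge0 // prodr_ge0.
  have sizei i : size (cells a (len (t1 ++ i :: t2))) = (a * M + a * S + a * v i)%N.
    rewrite size_len /S !big_cat /= big_cons size_cat /= -st; ring.
  (* Either every length of the exchanged cell fits, or the overflow term alone is at least 1 and
     dominates. *)
  have [fits|over] := leqP (a * M + a * S + a * h) N; last first.
    have avg (mu : I -> R) : (forall i, 0 <= mu i) -> \sum_i mu i = 1 ->
        0 <= \sum_i mu i * F (t1 ++ i :: t2) <= 1.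
      move=> pm sm; apply/andP; split.
        by apply: sumr_ge0 => i _; rewrite mulr_ge0 //; case/andP: (F01 (t1 ++ i :: t2)).
      rewrite -sm; apply: ler_sum => i _; rewrite ler_piMr //.
      by case/andP: (F01 (t1 ++ i :: t2)).
    have one := overflow _ over.
    have -> : \sum_i (mu0 i - mu1 i) * F (t1 ++ i :: t2) =
        \sum_i mu0 i * F (t1 ++ i :: t2) - \sum_i mu1 i * F (t1 ++ i :: t2).
      by rewrite -sumrB; apply: eq_bigr => i _; rewrite mulrBl.
    have := avg _ p0 s0; have := avg _ p1 s1.
    by rewrite ler_norml; lra.
  (* [u] ends with the zeros of the exchanged cell, and [P] is the padding left when that cell has
     no ones. *)
  pose u := cells a (len t1) ++ nseq a false.
  pose y := cells a (len t2).
  pose P := (N - (a * M + a * S))%N.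
  have HP : (a * h <= P)%N by rewrite /P leq_subRL // (leq_trans _ fits) // leq_addr.
  have [X [X1 X2]] := trace_mean_newton rho01 u y HP T_norm.
  have FE i : F (t1 ++ i :: t2) = \sum_(s < (a * h).+1) 'C(a * v i, s)%:R * X s.
    have avh : (a * v i <= a * h)%N by rewrite leq_mul2l vh orbT.
    rewrite -X2 // /F /word sizei ifT; last by rewrite (leq_trans _ fits) // leq_add2l.
    congr trace_mean; rewrite /u /y /len map_cat cells_cat /= cells_cons -!catA.
    by do 4![congr cat]; congr nseq; rewrite /P subnDA.
  have -> : \sum_i (mu0 i - mu1 i) * F (t1 ++ i :: t2) = \sum_i (mu0 i - mu1 i) *
      \sum_(s < (a * h).+1) 'C(a * v i, s)%:R * X s.
    by apply: eq_bigr => i _; rewrite FE.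
  apply: le_trans (moment_gap p0 p1 s0 s1 mm vh _ X1 _) _; last by rewrite lerDl.
    rewrite mulr_ge0 // subr_ge0 /unsampled; case/andP: rho01 => r0 r1.
    by apply: exprn_ile1; lra.
  apply: le_trans samples; have := bernoulli rho01 k; rewrite -/(unsampled k rho).
  have : 0 <= ((a * h)%:R : R) by [].
  by move: (unsampled k rho) (k%:R * rho) (_%:R) => b c d; nra.
have upper : expect mu1 M F <= 1 / 3.
  rewrite -[leRHS](expect_cst M (1 / 3) s1); apply: expect_le => // t st at_.
  rewrite /F; case: ifP => [hs|_]; last by lra.
  apply: acceptance_far => //; last by rewrite size_map.
  rewrite all_map; apply: sub_all at_ => i /= /v1 vi.
  by rewrite leq_pmulr.
have nR : 0 < (n%:R : R) by rewrite ltr0n ltnW.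
have lower : 2 / 3 - 16 / 100 - kappa * Q ^+ M <= expect mu0 M F.
  (* Pointwise lower bound for [F]: the first penalty is at least 2 with too many nonzero lengths,
     the second at least 1 when the cells do not fit. *)
  pose G t : R := 2 / 3 + (- (4 / n%:R) * \sum_(i <- t) (v i != 0%N)%:R +
                    - kappa * \prod_(i <- t) q i).
  apply: (@le_trans _ _ (expect mu0 M G)).
    rewrite /G expectD expect_cst // expectD !expectZ expect_additive //.
    rewrite expect_multiplicative.
    have : (\sum_i mu0 i * q i) ^+ M <= Q ^+ M.
      apply: lerXn2r; rewrite ?nnegrE ?qQ ?expR_ge0 //.
      by apply: sumr_ge0 => i _; rewrite mulr_ge0.
    move/(ler_wpM2l (expR_ge0 _ : 0 <= kappa)).
    have : 4 / n%:R * (M%:R * \sum_i mu0 i * (v i != 0%N)%:R) <= 16 / 100.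
      have -> : (M%:R : R) = 4 * n%:R by rewrite /M natrM.
      have -> e : 4 / n%:R * (4 * n%:R * e) = 16 * e :> R.
        by field; exact: lt0r_neq0.
      by lra.
    by rewrite !mulNr; lra.
  apply: expect_le => // t st _; rewrite /G.
  have kq0 : 0 <= kappa * \prod_(i <- t) q i by rewrite mulr_ge0 ?expR_ge0 // prodr_ge0.
  have cnt : \sum_(i <- t) (v i != 0%N)%:R = (count (predC1 0%N) (len t))%:R :> R.
    elim: t {st kq0} => [|i t IH]; first by rewrite big_nil.
    by rewrite big_cons IH /= natrD muln_eq0 (gtn_eqF a_gt0).
  have /andP[F0 _] := F01 t.
  rewrite cnt; set K := count _ _.
  have d0 : 0 < 4 / (n%:R : R) by rewrite divr_gt0.
  have [few_|many] := ltnP (2 * K) n.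
    have K0 : 0 <= (K%:R : R) by [].
    case: (leqP (size (cells a (len t))) N) => hs.
      have -> : F t = acceptance (word N a (len t)) by rewrite /F hs.
      have := acceptance_few hs few_.
      by move: (4 / n%:R) d0 => d d0; nra.
    have over : (N < a * M + a * \sum_(i <- t) v i + a * h)%N.
      by rewrite -mulnDr -st -size_len (leq_trans hs) // leq_addr.
    have := overflow t over; rewrite /F leqNgt hs /=; move: (4 / n%:R) d0 => d d0; nra.
  have : 2 <= 4 / n%:R * K%:R :> R.
    rewrite mulrAC ler_pdivlMr // -!natrM ler_nat.
    by rewrite (leq_trans (leq_mul (leqnn 2) many)) // mulnA.
  by lra.
have mbound : M%:R * (2 * 2 ^- m.+1) <= 1 / 100 :> R.
  have h1 : (n < 2 ^ (trunc_log 2 n).+1)%N by apply: trunc_log_ltn.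
  have : (512 * n <= 2 ^ m)%N.
    rewrite /m /degree -[10%N]/(1 + 9)%N addnA expnD addn1 mulnC leq_mul //.
    exact: ltnW.
  rewrite -(ler_nat R) natrM natrX.
  have -> : (2 : R) * 2 ^- m.+1 = 2 ^- m.
    by rewrite exprS invfM mulrA divff ?pnatr_eq0 // mul1r.
  rewrite /M natrM => hm; rewrite ler_pdivrMr ?exprn_gt0 //.
  by move: (2 ^+ m) hm => e; lra.
(* As [N >= 40na], the exponent is at most [1/2 + 2n/h + 8n/h - 20n/h]. *)
have kbound : 4 * n%:R * (kappa * Q ^+ M) <= 1 / 100.
  apply: le_trans (chernoff_small nR hR hn); rewrite ler_wpM2l ?mulr_ge0 //.
  rewrite /kappa /Q -expRM_natl -expRD ler_expR.
  have aN : 40 * (n%:R * a%:R) <= N%:R :> R by rewrite -!natrM ler_nat a_le.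
  rewrite /M !natrM.
  have -> : (a%:R * h%:R + a%:R * (4 * n%:R) - N%:R) / (2 * (a%:R * h%:R)) +
      4 * n%:R * (2 / h%:R) =
      1 / 2 - 10 * n%:R / h%:R + (40 * (n%:R * a%:R) - N%:R) / (2 * (a%:R * h%:R)) :> R.
    by field; apply/andP; split; exact: lt0r_neq0.
  by rewrite gerDl mulr_le0_ge0 //; lra.
have n1 : 1 <= (n%:R : R) by rewrite ler1n ltnW.
have kQ : 0 <= kappa * Q ^+ M by rewrite mulr_ge0 ?exprn_ge0 // expR_ge0.
have ME : (M%:R : R) = 4 * n%:R by rewrite /M natrM.
move: swap; rewrite mulrDr [X in _ <= _ + X * _]ME ler_norml => /andP[_].
have : kappa * Q ^+ M <= 1 / 100.
  by apply: le_trans kbound; rewrite ler_peMl //; lra.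
by lra.
Qed.

End Testers.

(** * Choice of the constants *)

Local Open Scope classical_set_scope.
Local Open Scope ring_scope.

Theorem theorem7p26 (R : realType) :
  exists eps0 : R, 0 < eps0 /\
  forall eps : R, 0 < eps <= eps0 ->
  exists N0 : nat -> nat,
    ((fun n : nat => (N0 n)%:R : R^o) \is 'Theta_\oo (fun n : nat => n%:R ^+ 2 : R^o)) /\
    exists c : R, 0 < c /\
    forall (n k N : nat) (rho : R) (T : k.-tuple (seq bool) -> R),
      (N0 n <= N)%N ->
      0 <= rho <= 1 ->
      trace_tester (block_strings N n) (far_rel_edit eps (block_strings N n))
        rho (2 / 3) T ->
      c * (n%:R / ln n%:R) <= k%:R * rho * N%:R.
Proof.
exists (1 / 40); split=> [|eps /andP[_ eps40]]; first by lra.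
exists (fun n => 40 * n ^ 2)%N; split.
  apply/asboolP; exists (40, 40) => /=; first by rewrite ltr0n.
  near=> n; rewrite natrM natrX.
  by have -> : `|40 * n%:R ^+ 2 : R| = 40 * `|n%:R ^+ 2 : R|
    by rewrite [LHS]normrM normr_nat.
have [n0 large] := spread_small R.
(* The factor [n0 + 1] settles [n < n0] through [samples_ge]; [300 * 300] exceeds the
   [201 * 17 * 22] met for large [n]. *)
pose c : R := (300 * 300 * n0.+1%:R)^-1.
have c_gt0 : 0 < c.
  by rewrite invr_gt0; apply: mulr_gt0; [apply: mulr_gt0|]; rewrite ltr0n.
exists c; split=> // n k N rho T Nn rho01 tester.
(* Here the logarithm is 0, at [n = 0] by convention, and so is its inverse; the left side
   vanishes. *)
have [n1|n2] := leqP n 1.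
  have -> : ln (n%:R : R) = 0 by case: n n1 {Nn tester} => [|[|n]] // _; rewrite ?ln1 // ln0.
  by case/andP: rho01 => r0 _; rewrite invr0 !mulr0 !mulr_ge0.
have N_ge : (40 * n <= N)%N.
  by apply: leq_trans Nn; rewrite leq_mul2l /= -mulnn leq_pmulr // ltnW.
have n_gt0 : (0 < n)%N := ltnW n2.
have l1 : (1 <= trunc_log 2 n)%N by rewrite trunc_log_gt0.
have ln_l := trunc_log_le_ln R n_gt0.
have ln_gt0' : 1 / 2 <= ln (n%:R : R).
  have : (1 : R) <= (trunc_log 2 n)%:R by rewrite ler1n.
  by lra.
set L := ln n%:R in ln_l ln_gt0' *.
have L0 : 0 < L by lra.
have nR : 0 < (n%:R : R) by rewrite ltr0n.
rewrite leNgt; apply/negP => few.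
have samples := samples_ge n2 N_ge rho01 eps40 tester.
pose d : R := n0.+1%:R.
have d1 : 1 <= d by rewrite /d ler1n.
have cd : c * d = 1 / 300 / 300.
  by rewrite /c -/d; field; apply: lt0r_neq0; lra.
have cL0 : 0 <= c / L by rewrite divr_ge0 // ltW.
have [n0n|nn0] := leqP n0 n; last first.
  suff : c * (n%:R / L) <= 1 / 6 by lra.
  apply: (@le_trans _ _ (c * (2 * d))); last by rewrite mulrCA cd; lra.
  apply: (ler_wpM2l (ltW c_gt0)); rewrite ler_pdivrMr //.
  have : (n%:R : R) <= d by rewrite ler_nat ltnW // ltnW.
  by nra.
apply: (no_tester n2 N_ge rho01 eps40 tester (large _ n0n)).
have c_le : c <= 1 / 300 / 300 by nra.
have u0 : 0 <= k%:R * rho by case/andP: rho01 => r0 _; rewrite mulr_ge0.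
set A := (N %/ (40 * n))%N.
have sample_bound : 40 * (k%:R * rho * A%:R) <= c / L.
  have AN : 40 * n%:R * A%:R <= N%:R :> R.
    by rewrite -!natrM ler_nat mulnC leq_trunc_div.
  have : 40 * (k%:R * rho * A%:R) * n%:R <= c / L * n%:R.
    apply: le_trans (_ : k%:R * rho * N%:R <= _).
      by have := ler_wpM2l u0 AN; move: (k%:R * rho) => u; lra.
    by apply: (le_trans (ltW few)); rewrite mulrA mulrAC.
  by rewrite ler_pM2r.
(* With [l] the truncated logarithm, [l + 10 <= 11 l <= 22 L]. *)
have DL : (degree n)%:R / L <= 22 :> R.
  rewrite ler_pdivrMr // /degree natrD.
  have : (1 : R) <= (trunc_log 2 n)%:R by rewrite ler1n.
  by lra.
have S_le := spread_le R n.
have D0 : 0 <= ((degree n)%:R : R) by [].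
rewrite natrM -(natr1 (degree n)).
move: (degree n)%:R (spread n)%:R S_le DL D0 (ler0n R (spread n)) => D S S_le DL D0 S0.
have h1 : 40 * (k%:R * rho * A%:R) * S <= c / L * (201 * 17 * D ^+ 2).
  by apply: ler_pM => //; apply: mulr_ge0 => //; apply: mulr_ge0.
have h2 : c / L * (201 * 17 * D ^+ 2) <= 201 * 17 * 22 * c * D.
  have -> : c / L * (201 * 17 * D ^+ 2) = 201 * 17 * c * D * (D / L).
    by field; exact: lt0r_neq0.
  have : 0 <= 201 * 17 * c * D by rewrite !mulr_ge0 // ltW.
  by move/(ler_wpM2l) => /(_ _ _ DL); lra.
have h3 : 201 * 17 * 22 * c * D <= D by nra.
have h := le_trans h1 (le_trans h2 h3).
have : 0 <= k%:R * rho * A%:R * S by apply: mulr_ge0 => //; apply: mulr_ge0.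
lra.
Unshelve. all: by end_near.
Qed.
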